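(* Let $A$ be a finite alphabet of size at least $2$ and let $k$ be a positive integer. Then the generic $A$-generated $k$-relation monoid presentation (with respect to either the sum length stratification or the maximum length stratification) has word problem solvable in linear time. The corresponding statement for semigroups also holds.
   Context: An $A$-generated $k$-relation monoid presentation $\langle A\mid R\rangle$ consists of the finite alphabet $A$ and a finite sequence $R$ of $k$ ordered pairs of words in $A^*$. Let $\equiv_R$ be the congruence on $A^*$ generated by $R$. Semigroup presentations are defined in the same way with the set $A^+$ of non-empty words in place of $A^*$. The relation words are the $2k$ words occurring as sides of the relations. The word problem for a fixed presentation $\langle A\mid R\rangle$ is the algorithmic problem of deciding, given as input words $u,v\in A^*$ (respectively $A^+$), whether $u\equiv_R v$. Linear time means time linear in the lengths of the input words $u$ and $v$, the presentation being fixed. Let $S$ be the set of all $A$-generated $k$-relation monoid (respectively, semigroup) presentations. The sum length (respectively, maximum length) stratification of $S$ is the sequence $(S_n)$ where $S_n$ is the finite set of presentations in $S$ whose sum of relation word lengths (respectively, length of longest relation word) is exactly $n$. A subset $X\subseteq S$ is generic if $\lim_{n\to\infty}|X\cap S_n|/|S_n|=1$. ''The generic presentation has property $Y$'' means that there is a generic subset of $S$ every member of which has property $Y$. *)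

(* Defs.v *)
From HB Require Import structures.
From mathcomp Require Import all_boot all_order all_algebra finmap.
From mathcomp Require Import all_classical all_reals all_analysis.

Set Implicit Arguments.
Unset Strict Implicit.
Unset Printing Implicit Defensive.

Import Order.TTheory GRing.Theory Num.Theory.
Import numFieldNormedType.Exports.

Local Open Scope classical_set_scope.
Local Open Scope ring_scope.

(** ** Free monoids, free semigroups and presentations *)

(* The free monoid A^* is [seq A] with [cat]; the free semigroup A^+ is the
   subtype of non-empty sequences. *)
Notation neword A := {w : seq A | w != [::]}.

Lemma neword_cat_subproof (A : eqType) (u v : neword A) :
  val u ++ val v != [::].
Proof. by case: u v => [[|a u] hu] [v hv]. Qed.

Definition neword_cat (A : eqType) (u v : neword A) : neword A :=
  exist _ (val u ++ val v) (neword_cat_subproof u v).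

Inductive congruence_gen (W : Type) (mul : W -> W -> W) (E : W -> W -> Prop) :
    W -> W -> Prop :=
| cg_rel u v : E u v -> congruence_gen mul E u v
| cg_refl u : congruence_gen mul E u u
| cg_sym u v : congruence_gen mul E u v -> congruence_gen mul E v u
| cg_trans u v w : congruence_gen mul E u v -> congruence_gen mul E v w ->
    congruence_gen mul E u w
| cg_mul u u' v v' : congruence_gen mul E u u' -> congruence_gen mul E v v' ->
    congruence_gen mul E (mul u v) (mul u' v').

Notation monoid_pres A k := (k.-tuple (seq A * seq A)).
Notation semigroup_pres A k := (k.-tuple (neword A * neword A)).

Definition monoid_equiv (A : finType) k (P : monoid_pres A k) :
    seq A -> seq A -> Prop :=
  congruence_gen cat (fun u v => (u, v) \in P).

Definition semigroup_equiv (A : finType) k (P : semigroup_pres A k) :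
    neword A -> neword A -> Prop :=
  congruence_gen (@neword_cat A) (fun u v => (u, v) \in P).

(** ** Deterministic multitape Turing machines *)

Inductive head_move := MoveLeft | Stay | MoveRight.

(* Two-way infinite tape, blank ([None]) outside of the finite part recorded:
   reversed cells to the left of the head, scanned cell, cells to the right. *)
Record tape (S : Type) := Tape {
  tape_left : seq (option S);
  tape_cur : option S;
  tape_right : seq (option S) }.

Definition tape_of_seq (S : Type) (s : seq S) : tape S :=
  Tape [::] (ohead s) (map Some (behead s)).

Definition tape_update (S : Type) (t : tape S) (act : option S * head_move) :
    tape S :=
  let: Tape l _ r := t in
  let: (x, m) := act in
  match m with
  | Stay => Tape l x r
  | MoveLeft => Tape (behead l) (head None l) (x :: r)
  | MoveRight => Tape (x :: l) (head None r) (behead r)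
  end.

(* A machine has [tm_work] work tapes besides its two input tapes, which may be
   written too.  Tape symbols are the blank, the input letters and finitely many
   auxiliary symbols.  A state [q] is halting iff [tm_verdict q] is [Some b],
   and [b] is then the answer. *)
Record turing_machine (A : finType) := TuringMachine {
  tm_work : nat;
  tm_aux : finType;
  tm_state : finType;
  tm_start : tm_state;
  tm_verdict : tm_state -> option bool;
  tm_trans : tm_state -> {ffun 'I_tm_work.+2 -> option (A + tm_aux)} ->
    tm_state * ('I_tm_work.+2 -> option (A + tm_aux) * head_move) }.

Section Execution.
Variables (A : finType) (M : turing_machine A).

Definition tm_config : Type :=
  tm_state M * ('I_(tm_work M).+2 -> tape (A + tm_aux M)).

Definition tm_step (c : tm_config) : tm_config :=
  if tm_verdict c.1 is Some _ then c else
  let: (q, act) := tm_trans c.1 [ffun i => tape_cur (c.2 i)] in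
  (q, fun i => tape_update (c.2 i) (act i)).

Definition tm_init (u v : seq A) : tm_config :=
  (tm_start M, fun i => tape_of_seq (map inl
     (if val i == 0%N then u else if val i == 1%N then v else [::]))).

Definition tm_answers_within (t : nat) (u v : seq A) (b : bool) : Prop :=
  tm_verdict (iter t tm_step (tm_init u v)).1 = Some b.

End Execution.

(* [W] is a type of words, read as elements of A^* through [word]. *)
Definition linear_time_decidable (A : finType) (W : Type) (word : W -> seq A)
    (E : W -> W -> Prop) : Prop :=
  exists (M : turing_machine A) (c : nat), forall u v : W,
    exists b : bool,
      tm_answers_within M (c * (size (word u) + size (word v) + 1))%N
        (word u) (word v) b
      /\ (b <-> E u v).

Definition monoid_wp_linear_time (A : finType) k (P : monoid_pres A k) : Prop :=
  linear_time_decidable id (monoid_equiv P).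

Definition semigroup_wp_linear_time (A : finType) k (P : semigroup_pres A k) :
    Prop :=
  linear_time_decidable val (semigroup_equiv P).

(** ** Stratifications and genericity *)

Section Lengths.
Variables (W : Type) (len : W -> nat) (k : nat).
Implicit Type P : k.-tuple (W * W).

Definition sum_length P : nat := (\sum_(r <- P) (len r.1 + len r.2))%N.

Definition max_length P : nat := (\max_(r <- P) maxn (len r.1) (len r.2))%N.

Definition sum_stratum (n : nat) : set (k.-tuple (W * W)) :=
  [set P | sum_length P = n].

Definition max_stratum (n : nat) : set (k.-tuple (W * W)) :=
  [set P | max_length P = n].

End Lengths.

Definition neword_size (A : eqType) (w : neword A) : nat := size (val w).

Section Generic.
Variables (R : realType) (T : choiceType) (S_ : nat -> set T).

(* [fset_set] is only meaningful on finite sets; the strata used are finite by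
   the lemmas below.  Empty strata (only finitely many of them occur) give the
   ratio 0 and do not affect the limit. *)
Definition generic (X : set T) : Prop :=
  (fun n => #|` fset_set (X `&` S_ n)|%:R / #|` fset_set (S_ n)|%:R : R)
    @ \oo --> (1 : R).

Definition generically (Y : T -> Prop) : Prop :=
  exists X : set T, generic X /\ forall P, X P -> Y P.

End Generic.

(** ** Finiteness of the strata *)

Lemma max_le_sum_length (W : Type) (len : W -> nat) k (P : k.-tuple (W * W)) :
  (max_length len P <= sum_length len P)%N.
Proof.
rewrite /max_length /sum_length; elim: (val P) => [|r s IH].
  by rewrite !big_nil.
rewrite !big_cons geq_max !geq_max; apply/andP; split; last first.
  exact: leq_trans IH (leq_addl _ _).
by rewrite -!addnA leq_addr addnCA leq_addr.
Qed.

Lemma finite_max_length_le (W : choiceType) (len : W -> nat) k n :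
  finite_set [set w | (len w <= n)%N] ->
  finite_set [set P : k.-tuple (W * W) | (max_length len P <= n)%N].
Proof.
move=> /finite_fsetP[F FE].
pose f (t : {ffun 'I_k -> F * F}) : k.-tuple (W * W) :=
  [tuple (val (t i).1, val (t i).2) | i < k].
apply: (@sub_finite_set _ _ (range f)); last first.
  exact/finite_image/finite_finset.
move=> P /= hP.
have hF i : ((tnth P i).1 \in F) && ((tnth P i).2 \in F).
  have hi : (maxn (len (tnth P i).1) (len (tnth P i).2) <= n)%N.
    apply: leq_trans hP; rewrite /max_length.
    by apply: (@leq_bigmax_seq _ _ _ (fun r => maxn (len r.1) (len r.2)));
      rewrite ?mem_tnth.
  move: hi; rewrite geq_max => /andP[h1 h2].
  have inF w : (len w <= n)%N -> w \in F.
    by move=> hw; have : [set` F] w by rewrite -FE.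
  by rewrite !inF.
exists [ffun i => (FSetSub (andP (hF i)).1, FSetSub (andP (hF i)).2)] => //.
by apply: eq_from_tnth => i; rewrite tnth_mktuple ffunE /=; case: (tnth P i).
Qed.

Lemma finite_word_le (A : finType) n :
  finite_set [set w : seq A | (size w <= n)%N].
Proof.
apply: (@sub_finite_set _ _ (range (fun b : n.-bseq A => val b))).
  by move=> w /= hw; exists (Bseq hw).
exact/finite_image/finite_finset.
Qed.

Lemma finite_neword_le (A : finType) n :
  finite_set [set w : neword A | (neword_size w <= n)%N].
Proof.
apply: (@finite_preimage _ _ [set w : seq A | (size w <= n)%N] val).
  by move=> x y _ _; apply: val_inj.
exact: finite_word_le.
Qed.

Lemma finite_strata (W : choiceType) (len : W -> nat) k n :
  (forall m, finite_set [set w | (len w <= m)%N]) ->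
  finite_set (sum_stratum len (k := k) n) /\
  finite_set (max_stratum len (k := k) n).
Proof.
move=> hfin; split; apply: sub_finite_set (@finite_max_length_le _ len k n _) => //.
  by move=> P /= <-; apply: max_le_sum_length.
by move=> P /= <-.
Qed.

Lemma finite_monoid_strata (A : finType) k n :
  finite_set (sum_stratum (@size A) (k := k) n) /\
  finite_set (max_stratum (@size A) (k := k) n).
Proof. exact/finite_strata/finite_word_le. Qed.

Lemma finite_semigroup_strata (A : finType) k n :
  finite_set (sum_stratum (@neword_size A) (k := k) n) /\
  finite_set (max_stratum (@neword_size A) (k := k) n).
Proof. exact/finite_strata/finite_neword_le. Qed.

(* Main.v *)
Require Import Defs.
From mathcomp Require Import all_boot all_order all_algebra finmap.
From mathcomp Require Import all_classical all_reals all_analysis.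
From mathcomp Require Import zify.

(* Call a presentation good if, for some L > 0, all relation words have length
   at least 4L and no word of length L occurs at two places in the relation
   words.

   Genericity.  If a word of length L occurs twice, one occurrence can be
   overwritten arbitrarily without losing information, so such presentations
   form a fraction at most 2^-L times the number of pairs of positions.  If some
   relation word is shorter than 4L, letters can be moved into it from a longest
   one (sum stratification) or arbitrary letters prepended (maximum
   stratification), which makes such presentations rare when L is a small
   constant multiple of n.

   Word problem.  Write each side of a relation as w = H Z with |Z| = L, and
   w' = H' Z' for the other side.  If some word equivalent to u starts with w,
   then all words equivalent to u start with H or H', and every rewriting step
   acts either on this front occurrence or strictly behind H resp. H'.  If there
   is no such word, the first letter of u is never touched and can be cancelled.
   A bounded prefix of u distinguishes the two situations well enough: if u
   starts with H and no other head overlaps the end of H, then H can be stripped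
   from both words.  What is left is to compare the remainders, possibly under
   the additional demand that they have an equivalent starting with a given word
   of length at most L; this is the problem one started with, in shorter words
   (a variant of Kambites' algorithm for small overlap monoids).  A machine that
   keeps bounded prefixes of both inputs in its state runs this in linear time. *)

Set Implicit Arguments.
Unset Strict Implicit.
Unset Printing Implicit Defensive.

(** * Rewriting with unique factors *)

Lemma drop_catl (T : Type) n (s t : seq T) :
  n <= size s -> drop n (s ++ t) = drop n s ++ t.
Proof.
rewrite drop_cat leq_eqVlt => /orP[/eqP->|->] //.
by rewrite ltnn subnn drop0 drop_size.
Qed.

Definition apply_edit (T : Type) (e : seq T * nat) u := e.1 ++ drop e.2 u.

(** An edit deletes only letters that are present and never lengthens the word, so an edited buffer
    still fits its capacity. *)
Definition sound_edit (T : Type) (u : seq T) (e : seq T * nat) :=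
  (size e.1 <= e.2) && (e.2 <= size u).

Section Rewriting.
Variables (A : eqType) (I : finType) (w : I -> seq A) (bar : I -> I).
Hypothesis barK : involutive bar.

Definition step (u v : seq A) : Prop :=
  exists x i y, u = x ++ w i ++ y /\ v = x ++ w (bar i) ++ y.

Inductive rewrites : nat -> seq A -> seq A -> Prop :=
| rewrites0 u : rewrites 0 u u
| rewritesS n u v v' : rewrites n u v -> step v v' -> rewrites n.+1 u v'.

Definition eqv (u v : seq A) : Prop := exists n, rewrites n u v.

Lemma step_sym u v : step u v -> step v u.
Proof. by move=> [x [i [y [-> ->]]]]; exists x, (bar i), y; rewrite barK. Qed.

Lemma step_cat a b u v : step u v -> step (a ++ u ++ b) (a ++ v ++ b).
Proof.
by move=> [x [i [y [-> ->]]]]; exists (a ++ x), i, (y ++ b); rewrite -!catA.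
Qed.

Lemma rewrites_cat n a b u v :
  rewrites n u v -> rewrites n (a ++ u ++ b) (a ++ v ++ b).
Proof.
elim=> [x|{}n x y z _ IH hs]; first exact: rewrites0.
exact: rewritesS IH (step_cat _ _ hs).
Qed.

Lemma eqv_refl u : eqv u u.
Proof. by exists 0; apply: rewrites0. Qed.

Lemma eqv_trans u v x : eqv u v -> eqv v x -> eqv u x.
Proof.
move=> huv [n hn]; elim: hn u huv => // {}n {}v y z _ IH hs u huv.
by have [m hm] := IH _ huv; exists m.+1; apply: rewritesS hm hs.
Qed.

Lemma step_eqv u v : step u v -> eqv u v.
Proof. by move=> hs; exists 1; apply: rewritesS (rewrites0 _) hs. Qed.

Lemma eqv_sym u v : eqv u v -> eqv v u.
Proof.
move=> [n]; elim=> [x|{}n x y z _ IH hs]; first exact: eqv_refl.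
exact: eqv_trans (step_eqv (step_sym hs)) IH.
Qed.

Lemma eqv_cat u u' v v' : eqv u u' -> eqv v v' -> eqv (u ++ v) (u' ++ v').
Proof.
move=> [n hn] [m hm]; apply: (@eqv_trans _ (u' ++ v)).
  by exists n; apply: (rewrites_cat [::] v hn).
by exists m; move: (rewrites_cat u' [::] hm); rewrite !cats0.
Qed.

Lemma eqv_catl x u v : eqv u v -> eqv (x ++ u) (x ++ v).
Proof. by apply: eqv_cat; apply: eqv_refl. Qed.

Lemma eqv_flip i z : eqv (w i ++ z) (w (bar i) ++ z).
Proof. by apply: step_eqv; exists [::], i, z. Qed.

Variable L : nat.
Hypothesis L_gt0 : 0 < L.
Hypothesis size_w : forall i, 4 * L <= size (w i).
Hypothesis factor_uniq : forall i j a b,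
  a + L <= size (w i) -> b + L <= size (w j) ->
  (forall t, t < L -> onth (w i) (a + t) = onth (w j) (b + t)) ->
  i = j /\ a = b.

Definition head i := take (size (w i) - L) (w i).
Definition tl i := drop (size (w i) - L) (w i).

Lemma cat_head_tl i : head i ++ tl i = w i.
Proof. exact: cat_take_drop. Qed.

Lemma size_head i : size (head i) = size (w i) - L.
Proof. by rewrite size_takel // leq_subr. Qed.

Lemma size_tl i : size (tl i) = L.
Proof. by rewrite size_drop; have := size_w i; lia. Qed.

Lemma head_gt i : 3 * L <= size (head i).
Proof. by rewrite size_head; have := size_w i; lia. Qed.

(** * Occurrences of factors of relation words *)

Definition located u p i a n :=
  a + n <= size (w i) /\
  forall t, t < n -> onth u (p + t) = onth (w i) (a + t).

(** The [L] letters from position [s] on lie in both occurrences, so they are a factor of both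
    relation words, and [factor_uniq] forces the same word and the same alignment. *)
Lemma located_overlap u p i a n q j b m s :
  located u p i a n -> located u q j b m -> p <= s -> q <= s ->
  s + L <= p + n -> s + L <= q + m -> i = j /\ a + (s - p) = b + (s - q).
Proof.
move=> [ha hu] [hb hu'] ps qs sp sq; apply: factor_uniq; [lia|lia|].
move=> t tL; rewrite -!addnA -hu -?hu'; [|lia..].
by congr onth; lia.
Qed.

Lemma located_shift u p i a n k : k <= n ->
  located u p i a n -> located u (p + k) i (a + k) (n - k).
Proof.
by move=> kn [h hu]; split; [lia|move=> t ht; rewrite -!addnA hu //; lia].
Qed.

Lemma located_catr x u p i a n :
  located (x ++ u) (size x + p) i a n -> located u p i a n.
Proof.
move=> [h hu]; split=> // t tn; rewrite -hu // onth_cat.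
by rewrite ltnNge -addnA leq_addr /= addKn.
Qed.

Lemma located_word x i y : located (x ++ w i ++ y) (size x) i 0 (size (w i)).
Proof.
split=> // t tn; rewrite onth_cat ltnNge leq_addr /= addKn onth_cat tn.
by [].
Qed.

Lemma located_head x i y :
  located (x ++ head i ++ y) (size x) i 0 (size (head i)).
Proof.
split; first by rewrite size_head; lia.
move=> t tn; rewrite onth_cat ltnNge leq_addr /= addKn onth_cat tn add0n.
by rewrite -[in RHS](cat_head_tl i) onth_cat tn.
Qed.

Lemma located_tl x i y :
  located (x ++ tl i ++ y) (size x) i (size (head i)) L.
Proof.
have hs := size_tl i; split.
  by rewrite -[in leqRHS](cat_head_tl i) size_cat hs.
move=> t tn; rewrite onth_cat ltnNge leq_addr /= addKn onth_cat hs tn.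
by rewrite -[in RHS](cat_head_tl i) onth_cat ltnNge leq_addr /= addKn.
Qed.

Lemma prefix_head_located p u i :
  p <= size u -> prefix (head i) (drop p u) -> located u p i 0 (size (head i)).
Proof.
move=> pu /prefixP[y hy]; rewrite -(cat_take_drop p u) hy.
by have := located_head (take p u) i y; rewrite size_takel.
Qed.

(** * Derivations starting with a relation word in front *)

Definition pair_of i i' := i' = i \/ i' = bar i.

(** History of the remainder behind the front word: each link is a stretch of derivation up to a
    rewriting of the front word, with one tail [tl i'] exposed to the remainder. *)
Inductive linked i : seq A -> seq A -> Prop :=
| linked0 z : linked i z z
| linkedS z y y' i' : linked i z y -> pair_of i i' ->
    eqv (tl i' ++ y) (tl i' ++ y') -> linked i z y'.

(* The bound [m <= n] on the derivation behind the head is what the strong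
   induction in [rewrites_pivot] consumes. *)
Definition pivot_property n := forall i z v, rewrites n (w i ++ z) v ->
  exists i' m y0 y', [/\ pair_of i i', m <= n, v = head i' ++ y',
    rewrites m (tl i' ++ y0) y' & linked i z y0].

Lemma step_nil v : ~ step [::] v.
Proof.
move=> [x [i [y [/(congr1 size) + _]]]]; rewrite !size_cat /=.
by have := size_w i; lia.
Qed.

(** If some step acts at position 0, the derivation after it starts from a word with a relation word
    in front; otherwise the first letter is never touched. *)
Lemma rewrites_front m s t : rewrites m s t ->
  (exists m' i z, m' <= m /\ rewrites m' (w i ++ z) t) \/
  (s = [::] /\ t = [::]) \/
  (exists a s1 t1, [/\ s = a :: s1, t = a :: t1 & rewrites m s1 t1]).
Proof.
elim=> [u|{}m {}s v {}t _ IH hs].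
  right; case: u => [|a u]; first by left.
  by right; exists a, u, u; split=> //; apply: rewrites0.
case: IH => [[m' [i [z [hm hr]]]]|[[_ v0]|[a [s1 [v1 [es ev hr]]]]]].
- by left; exists m'.+1, i, z; split=> //; apply: rewritesS hr hs.
- by move: hs; rewrite v0 => /step_nil.
move: hs; rewrite ev => -[[|b x] [i [y [e1 e2]]]].
  by left; exists 0, (bar i), y; split=> //; rewrite e2; apply: rewrites0.
right; right; case: e1 => eb e1; exists a, s1, (x ++ w (bar i) ++ y).
split=> //; first by rewrite e2 eb.
by apply: rewritesS hr _; rewrite e1; exists x, i, y.
Qed.

(** Were the first letter touched, the pivot property would put a head at the front of [t], sharing
    [L] letters with a factor at offset [o > 0] of its relation word, against uniqueness. So the
    letter is common, and the argument repeats while [L] letters of the factor remain. *)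
Lemma front_stable N (pivotN : forall m, m <= N -> pivot_property m) c :
  forall m s t j o n, m <= N -> rewrites m s t -> located t 0 j o n ->
  0 < o -> c + L <= n -> forall r, r < c -> onth s r = onth t r.
Proof.
elim: c => [//|c IH] m s t j o n mN hr ht o0 cn r rc.
case: (rewrites_front hr) => [[m' [i [z [hm hr']]]]|[[-> ->] //|]].
  have [i' [m1 [y0 [y' [_ _ et _ _]]]]] := pivotN _ (leq_trans hm mN) _ _ _ hr'.
  have hh := located_head [::] i' y'; rewrite -et /= in hh.
  have := @located_overlap _ _ _ _ _ _ _ _ _ 0 ht hh; have := head_gt i'.
  by move=> ? [] //; lia.
move=> [a [s1 [t1 [-> et hr1]]]]; rewrite et; case: r rc => [//|r] rc /=.
apply: (IH m _ _ j o.+1 n.-1 mN hr1) => //; last by lia.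
have := @located_shift _ _ _ _ _ 1 _ ht; rewrite et add0n addn1 subn1 => h.
by apply: (@located_catr [:: a]) => /=; apply: h; lia.
Qed.

(** An overlap of [L] letters with the front head contradicts uniqueness. If it is shorter, the
    inner word reaches over [2 * L] letters into [y]; by [front_stable] the first [L] of them are
    those of [tl i], which would then occur in [w j] at an offset below [size (head i)]. *)
Lemma no_inner N (pivotN : forall m, m <= N -> pivot_property m) i m y0 y p j n :
  m <= N -> rewrites m (tl i ++ y0) y -> located (head i ++ y) p j 0 n ->
  3 * L <= n -> 0 < p < size (head i) -> False.
Proof.
move=> mN hr hp n3 /andP[p0 ph].
have hh := located_head [::] i y; have hi := head_gt i.
case: (leqP (p + L) (size (head i))) => hpL.
  by have [||||_] := located_overlap (s := p) hp hh; rewrite /= ?add0n //; lia.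
set o := size (head i) - p.
have hy : located y 0 j o (n - o).
  apply: (@located_catr (head i)); rewrite addn0.
  have -> : size (head i) = p + o by rewrite /o; lia.
  by rewrite -[X in located _ _ _ X _]add0n; apply: located_shift hp; rewrite /o; lia.
have hst := @front_stable N pivotN L _ _ _ _ _ _ mN hr hy.
have [lt agt] := located_tl [::] i y0.
have hy' : located y 0 i (size (head i)) L.
  split=> // t tL; rewrite -agt // add0n; apply/esym/hst => //; rewrite /o; lia.
by have [||||_] := located_overlap (s := 0) hy hy'; rewrite ?add0n //; lia.
Qed.

Lemma head_inj i j y z : head i ++ y = head j ++ z -> i = j /\ y = z.
Proof.
move=> e; have hi := located_head [::] i y; rewrite /= e in hi.
have hj := located_head [::] j z; have li := head_gt i; have lj := head_gt j.
have [||||ij _] := located_overlap (s := 0) hi hj; rewrite /= ?add0n //; [lia..|].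
by split=> //; move: e; rewrite ij => /eqP; rewrite eqseq_cat // eqxx => /eqP.
Qed.

Lemma pair_bar i i' : pair_of i i' -> pair_of i (bar i').
Proof. by case=> ->; [right|left; rewrite barK]. Qed.

Lemma rewrites_inv n u v : rewrites n u v ->
  n = 0 /\ v = u \/ exists m x, [/\ n = m.+1, rewrites m u x & step x v].
Proof. by case=> [x|m x y z h1 h2]; [left|right; exists m, y]. Qed.

(** The last step acts either at the front, exchanging the front word and adding a link, or behind
    the front head, extending the derivation there; [no_inner] excludes the positions in between. *)
Lemma rewrites_pivot n : pivot_property n.
Proof.
elim/ltn_ind: n => n IH i z v /rewrites_inv[[n0 ->]|[m [u [en hr hs]]]].
  exists i, 0, z, (tl i ++ z); split; first by left.
  - by rewrite n0.
  - by rewrite catA cat_head_tl.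
  - exact: rewrites0.
  - exact: linked0.
have IHm k : k <= m -> pivot_property k by move=> km; apply: IH; rewrite en ltnS.
have [i' [k [y0 [y [hp km eu hk hl]]]]] := IHm _ (leqnn m) _ _ _ hr.
case: hs => x [j [t [e1 e2]]]; have hj := located_word x j t.
have w3 : 3 * L <= size (w j) by have := size_w j; lia.
rewrite -e1 eu in hj; have [xh|hx] := ltnP (size x) (size (head i')).
  case: x e1 e2 hj xh => [|a x] e1 e2 hj xh; last first.
    by have := @no_inner m IHm _ _ _ _ _ _ _ km hk hj w3 => /(_ xh).
  have [ij ey] : i' = j /\ y = tl j ++ t.
    by apply: head_inj; rewrite -eu e1 /= catA cat_head_tl.
  exists (bar j), 0, t, (tl (bar j) ++ t); split=> //.
  - by rewrite -ij; apply: pair_bar.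
  - by rewrite e2 /= catA cat_head_tl.
  - exact: rewrites0.
  - by apply: linkedS hl hp _; exists k; rewrite {2}ij -ey.
have [x' ex] : exists x', x = head i' ++ x'.
  exists (drop (size (head i')) x).
  have /(congr1 (take (size (head i')))) := e1; rewrite eu take_size_cat //.
  by rewrite takel_cat // => {1}->; rewrite cat_take_drop.
exists i', k.+1, y0, (x' ++ w (bar j) ++ t); split=> //.
- by rewrite en ltnS.
- by rewrite e2 ex -catA.
- apply: rewritesS hk _; exists x', j, t; split=> //.
  have := e1; rewrite eu ex -catA => /eqP; rewrite eqseq_cat // eqxx.
  by move=> /= /eqP.
Qed.

(** * Equivalent words compared letter by letter from the front *)

Definition head_at u p i := prefix (head i) (drop p u).

Lemma head_at_located u p i :
  head_at u p i -> located u p i 0 (size (head i)).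
Proof.
move=> h; apply: prefix_head_located => //; case: (leqP p (size u)) => // pu.
by move: h; rewrite /head_at drop_oversize ?(ltnW pu) // prefixs0 -size_eq0;
  have := head_gt i; lia.
Qed.

Lemma eqv_front u v : eqv u v ->
  (exists i z, eqv u (w i ++ z)) \/ (u = [::] /\ v = [::]) \/
  (exists a u1 v1, [/\ u = a :: u1, v = a :: v1 & eqv u1 v1]).
Proof.
move=> /eqv_sym[n hn]; case: (rewrites_front hn) => [[m [i [z [_ hm]]]]|[[-> ->]|]].
- by left; exists i, z; apply: eqv_sym; exists m.
- by right; left.
move=> [a [s [t [-> -> h]]]]; right; right; exists a, t, s; split=> //.
by apply: eqv_sym; exists n.
Qed.

Lemma eqv_pivot i z v : eqv (w i ++ z) v ->
  exists i' y0 y', [/\ pair_of i i', v = head i' ++ y',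
    eqv (tl i' ++ y0) y' & linked i z y0].
Proof.
move=> [n /rewrites_pivot[i' [m [y0 [y' [hp _ ev hm hl]]]]]].
by exists i', y0, y'; split=> //; exists m.
Qed.

Lemma pivot_no_inner i z u k p j : eqv (w i ++ z) u -> head_at u 0 k ->
  head_at u p j -> 0 < p < size (head k) -> False.
Proof.
move=> [n hn]; rewrite /head_at drop0 => /prefixP[y eu] hj hp.
have [i' [m [y0 [y' [_ _ eu' hm _]]]]] := rewrites_pivot hn.
have [ki yy] : i' = k /\ y' = y by apply: head_inj; rewrite -eu.
move: (head_at_located hj); rewrite eu -yy -ki => hl; rewrite -ki in hp.
exact: (@no_inner m (fun k _ => @rewrites_pivot k) _ _ _ _ _ _ _
  (leqnn m) hm hl (head_gt j) hp).
Qed.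

Lemma pivot_head i z u : eqv u (w i ++ z) -> exists k, head_at u 0 k.
Proof.
move=> /eqv_sym/eqv_pivot[i' [_ [y' [_ -> _ _]]]]; exists i'.
by rewrite /head_at drop0 prefix_prefix.
Qed.

Lemma eqv_strip1 u v : (forall i z, ~ eqv u (w i ++ z)) -> eqv u v ->
  (u = [::] /\ v = [::]) \/
  (exists a u1 v1, [/\ u = a :: u1, v = a :: v1 & eqv u1 v1]).
Proof. by move=> hn /eqv_front[[i [z h]]|//]; have := hn i z. Qed.

(** Where no head starts, no relation word can be brought to the front, so the letter is fixed and
    can be cancelled. *)
Lemma eqv_strip c u v : (forall p i, p < c -> ~~ head_at u p i) ->
  c <= size u -> eqv u v ->
  exists x u' v', [/\ u = x ++ u', v = x ++ v', size x = c & eqv u' v'].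
Proof.
elim: c u v => [|c IH] u v hh cu huv; first by exists [::], u, v.
have h0 i z : ~ eqv u (w i ++ z).
  by move=> /pivot_head[k]; apply/negP/hh.
case: (eqv_strip1 h0 huv) => [[e _]|[a [u1 [v1 [eu ev h1]]]]].
  by rewrite e in cu.
move: hh cu; rewrite eu ev => hh cu.
have [|//|x [u' [v' [-> -> <- h]]]] := IH u1 v1 _ _ h1.
  by move=> p i pc; apply: (hh p.+1 i).
by exists (a :: x), u', v'.
Qed.

(** Letters of [Z] are cancelled up to the first suffix [o] from which a relation word can be
    brought to the front. *)
Lemma eqv_lead Z x y : eqv (Z ++ x) y ->
  (exists y1, y = Z ++ y1 /\ eqv x y1) \/
  (exists z1 o j z y1, [/\ Z = z1 ++ o, o != [::], y = z1 ++ y1,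
     eqv (o ++ x) y1 & eqv (o ++ x) (w j ++ z)]).
Proof.
elim: Z y => [|a Z IH] y hy; first by left; exists y.
case: (eqv_front hy) => [[i [z h]]|[[]//|[b [u1 [v1 [[<- <-] -> h1]]]]]].
  by right; exists [::], (a :: Z), i, z, y.
case: (IH _ h1) => [[y1 [-> h2]]|[z1 [ o [j [z [y1 [-> o0 -> h2 h3]]]]]]].
  by left; exists y1.
by right; exists (a :: z1), o, j, z, y1.
Qed.

(* The part of [tl i] that takes part in rewriting [tl i ++ x] is determined by
   [x], hence is the same for both sides of a relation. *)
Lemma straddle_uniq o o' x j j' : size o <= L -> size o' <= L ->
  head_at (o ++ x) 0 j -> head_at (o' ++ x) 0 j' -> o = o'.
Proof.
move=> oL oL' /head_at_located h /head_at_located h'.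
have hj := head_gt j; have hj' := head_gt j'.
have front s k : size s <= L -> located (s ++ x) 0 k 0 (size (head k)) ->
    located x 0 k (size s) (size (head k) - size s).
  move=> sL hs; apply: (@located_catr s); rewrite addn0 -[X in located _ X]add0n.
  by rewrite -[X in located _ _ _ X _]add0n; apply: located_shift hs;
    have := head_gt k; lia.
have [||||jj ss] := located_overlap (s := 0) (front _ _ oL h) (front _ _ oL' h');
  [lia..|].
rewrite !addn0 in ss; subst j'.
apply: eq_from_onth => t; have [to|ot] := ltnP t (size o); last first.
  by rewrite !onth_default // -ss.
have tj : t < size (head j) by lia.
by have := h.2 t tj; rewrite -(h'.2 t tj) !add0n !onth_cat -ss to.
Qed.

(** * Remainders behind a front relation word, compared modulo its two tails *)

Definition zeqv i x x' := eqv (tl i ++ x) (tl i ++ x').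
(** Once a word starts with the full relation word [i], either side can be put there, so either tail
    may interact with the remainder. *)
Definition flip_eqv i x x' := zeqv i x x' \/ zeqv (bar i) x x'.

Lemma zeqv_trans i x y z : zeqv i x y -> zeqv i y z -> zeqv i x z.
Proof. exact: eqv_trans. Qed.

Lemma zeqv_cases i x x' : zeqv i x x' -> eqv x x' \/
  exists z1 o k, [/\ tl i = z1 ++ o, size o <= L, eqv (o ++ x) (o ++ x') &
    head_at (o ++ x) 0 k /\ exists k', head_at (o ++ x') 0 k'].
Proof.
move=> /eqv_lead[[y1 [/eqP]]|[z1 [ o [j [z [y1 [ez _ ey h hj]]]]]]].
  by rewrite eqseq_cat // eqxx => /eqP -> h; left.
right; have ey1 : y1 = o ++ x'.
  by move/eqP: ey; rewrite ez -catA eqseq_cat // eqxx => /eqP.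
have [k hk] := pivot_head hj; exists z1, o, k; split=> //.
- by rewrite -(size_tl i) ez size_cat leq_addl.
- by rewrite -ey1.
- split=> //; apply: (@pivot_head j z).
  by apply: eqv_trans hj; rewrite -ey1; apply: eqv_sym.
Qed.

(** If one of the tails is inert, its remainders are equivalent outright and the other tail serves
    for both links. Otherwise both tails contribute a suffix to a head continued in the same [y]; by
    [straddle_uniq] the suffixes agree, so one tail carries both links. *)
Lemma flip_eqv_trans i i' x y z : pair_of i i' ->
  flip_eqv i x y -> zeqv i' y z -> flip_eqv i x z.
Proof.
move=> hp hxy hyz.
have [k [hk hxy']] : exists k, pair_of i k /\ zeqv k x y.
  by case: hxy => h; [exists i|exists (bar i)]; split=> //; [left|right].
have flip_of m : pair_of i m -> zeqv m x z -> flip_eqv i x z.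
  by case=> ->; [left|right].
case: (zeqv_cases hxy') => [h|[z1 [ o [j [ez oL h [_ [j' hj]]]]]]].
  by apply: (flip_of i') => //; apply: zeqv_trans hyz; apply: eqv_catl.
case: (zeqv_cases hyz) => [h'|[z1' [ o' [m [ez' oL' h' [hm _]]]]]].
  by apply: (flip_of k) => //; apply: zeqv_trans hxy' _; apply: eqv_catl.
have e := straddle_uniq oL oL' hj hm; rewrite -e in h'.
apply: (flip_of k) => //; rewrite /zeqv ez -!catA.
by apply: eqv_catl; apply: eqv_trans h h'.
Qed.

Lemma linked_flip_eqv i x y : linked i x y -> flip_eqv i x y.
Proof.
elim=> [z|z y1 y' i' _ IH hp h]; first by left; apply: eqv_refl.
exact: flip_eqv_trans hp IH h.
Qed.

Lemma flip_eqv_sym i x y : flip_eqv i x y -> flip_eqv i y x.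
Proof. by case=> h; [left|right]; apply: eqv_sym. Qed.

Lemma pair_of_cases i i' x y : pair_of i i' -> zeqv i' x y -> flip_eqv i x y.
Proof. by case=> -> h; [left|right]. Qed.

Lemma flip_eqv_transl i x y z : flip_eqv i x y -> flip_eqv i y z -> flip_eqv i x z.
Proof.
move=> h [] h'; first by apply: flip_eqv_trans h h'; left.
by apply: flip_eqv_trans h h'; right.
Qed.

Lemma eqv_word_flip i i' j z z' : pair_of i i' -> pair_of i j ->
  flip_eqv i z z' -> eqv (w i' ++ z) (w j ++ z').
Proof.
have go k l y : pair_of i k -> pair_of i l -> eqv (w k ++ y) (w l ++ y).
  move=> hk hl; have [->|hkl] := eqVneq k l; first exact: eqv_refl.
  suff -> : l = bar k by apply: eqv_flip.
  by case: hk hl hkl => -> [] -> //; rewrite ?eqxx // barK.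
move=> hi hj h.
have [k [hk h']] : exists k, pair_of i k /\ zeqv k z z'.
  by case: h; [exists i|exists (bar i)]; split=> //; [left|right].
apply: eqv_trans (go _ k _ hi hk) _; apply: eqv_trans (go k _ _ hk hj).
by rewrite -(cat_head_tl k) -!catA; apply: eqv_catl.
Qed.

(** * Words with a clean head in front *)

Definition clean u i := head_at u 0 i &&
  all (fun p => [forall j, ~~ head_at u p j]) (iota 1 (size (head i)).-1).

Lemma cleanP u i : reflect
  (head_at u 0 i /\ forall p j, 0 < p < size (head i) -> ~~ head_at u p j)
  (clean u i).
Proof.
have hi := head_gt i; apply: (iffP andP) => -[h0 h]; split=> //.
  move=> p j hp; have /allP/(_ p) := h; rewrite mem_iota.
  by move=> /(_ _)/forallP; apply; lia.
apply/allP => p; rewrite mem_iota => hp; apply/forallP => j; apply: h; lia.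
Qed.

(** A test on a bounded prefix thus certifies that the first letter is fixed. A clean word need not
    reach a relation word in front; [clean_eqv] allows for both cases. *)
Lemma unclean_no_pivot u : (forall i, ~~ clean u i) ->
  forall i z, ~ eqv u (w i ++ z).
Proof.
move=> hu i z h; have [k hk] := pivot_head h; have /negP := hu k; apply.
apply/cleanP; split=> // p j hp; apply/negP => hj.
exact: pivot_no_inner (eqv_sym h) hk hj hp.
Qed.

Lemma flip_eqv_bar i x y : flip_eqv i x y -> flip_eqv (bar i) x y.
Proof. by case=> h; [right; rewrite barK|left]. Qed.

Lemma flip_eqv_pair i i' x y : pair_of i i' -> flip_eqv i x y -> flip_eqv i' x y.
Proof. by case=> -> //; apply: flip_eqv_bar. Qed.

(** If a relation word can be brought to the front, both words pivot on it. Otherwise the first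
    letter is fixed, and as no head starts inside [head i], the rest of that head is fixed too. *)
Lemma clean_eqv i y v : clean (head i ++ y) i -> eqv (head i ++ y) v ->
  (exists y', v = head i ++ y' /\ eqv y y') \/
  exists i' y' x x', [/\ pair_of i i', v = head i' ++ y', eqv y (tl i ++ x),
    eqv y' (tl i' ++ x') & flip_eqv i x x'].
Proof.
set u := head i ++ y => /cleanP[h0 hin] huv; have hi := head_gt i.
case: (eqv_front huv) => [[j [z h]]|[[e _]|[a [u1 [v1 [eu ev h1]]]]]].
- have [i1 [x [y1 [hp1 e1 hx hl]]]] := eqv_pivot (eqv_sym h).
  have [ii yy] : i = i1 /\ y = y1 by apply: head_inj; rewrite -e1.
  have [i2 [x' [y2 [hp2 e2 hx' hl']]]] := eqv_pivot (eqv_trans (eqv_sym h) huv).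
  right; subst i1 y1; exists i2, y2, x, x'; split=> //.
  + by case: hp1 hp2 => -> [] ->; rewrite /pair_of ?barK; [left|right|right|left].
  + exact: eqv_sym.
  + exact: eqv_sym.
  + apply: (@flip_eqv_pair j) => //.
    by apply: flip_eqv_transl (linked_flip_eqv hl'); apply/flip_eqv_sym/linked_flip_eqv.
- by move: (congr1 size e); rewrite /u size_cat /=; lia.
have [||x [u2 [v2 [e1 e2 sx h2]]]] := @eqv_strip (size (head i)).-1 u1 v1 _ _ h1.
- by move=> p k pk; have := hin p.+1 k; rewrite eu; apply; lia.
- by move: (congr1 size eu); rewrite /u size_cat /=; lia.
have [ex ey] : a :: x = head i /\ u2 = y.
  move: eu; rewrite /u e1 => /eqP; rewrite -cat_cons eqseq_cat /=; last by lia.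
  by move=> /andP[/eqP -> /eqP ->].
by left; exists v2; rewrite -ey ev e2 -ex.
Qed.

Lemma prefix_tl_eqv i y x : prefix (tl i) y = false -> eqv y (tl i ++ x) ->
  exists z1 o k y1, [/\ tl i = z1 ++ o, o != [::], y = z1 ++ y1,
    eqv (o ++ x) y1 & size o <= L /\ head_at (o ++ x) 0 k].
Proof.
move=> hy /eqv_sym/eqv_lead[[y1 [e _]]|[z1 [ o [j [z [y1 [e o0 ey h hj]]]]]]].
  by move: hy; rewrite e prefix_prefix.
have [k hk] := pivot_head hj; exists z1, o, k, y1; split=> //; split=> //.
by rewrite -(size_tl i) e size_cat leq_addl.
Qed.

(** A comparison through the other tail either leaves that tail inert or uses the same suffix [o];
    both carry over to [tl i]. *)
Lemma flip_eqv_straddle i z1 o x x' k : tl i = z1 ++ o -> size o <= L ->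
  head_at (o ++ x) 0 k -> flip_eqv i x x' -> zeqv i x x'.
Proof.
move=> e oL ho [//|/zeqv_cases[h|[z2 [ o' [k' [_ oL' h [ho' _]]]]]]].
  exact: eqv_catl.
rewrite /zeqv e -!catA (straddle_uniq oL oL' ho ho').
exact: eqv_catl.
Qed.

Lemma flip_eqv_nonprefix i y x x' : prefix (tl i) y = false ->
  eqv y (tl i ++ x) -> flip_eqv i x x' -> zeqv i x x'.
Proof.
move=> hy /(prefix_tl_eqv hy)[z1 [ o [k [y1 [e _ _ _ [oL ho]]]]]].
exact: flip_eqv_straddle e oL ho.
Qed.

Definition straddled i x :=
  has (fun p => [exists j, head_at (tl i ++ x) p j]) (iota 0 L).

(** If a head starts inside the tail, this tail achieves all that the other one can. If none does,
    the tail cancels, the remainders are equivalent outright and the other tail serves as well. *)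
Lemma flip_eqv_dec i x x' :
  flip_eqv i x x' <-> zeqv (if straddled i x then i else bar i) x x'.
Proof.
case: (boolP (straddled i x)) => [/hasP[p]|hn].
  rewrite mem_iota /= add0n => pL /existsP[j]; rewrite /head_at drop_cat size_tl pL.
  rewrite -{1}(drop0 (drop p _ ++ _)) => hj; split; last by left.
  apply: (@flip_eqv_straddle i (take p (tl i)) _ x x' j _ _ hj).
    by rewrite cat_take_drop.
  by rewrite size_drop size_tl leq_subr.
split; last by right.
case=> // h; have [||z [u' [v' [eu ev sz h']]]] := @eqv_strip L _ _ _ _ h.
- move=> p j pL; apply: contra hn => hj; apply/hasP; exists p; first by rewrite mem_iota.
  by apply/existsP; exists j.
- by rewrite size_cat size_tl leq_addr.
apply: eqv_catl; move: eu ev => /eqP + /eqP.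
by rewrite !eqseq_cat ?size_tl // => /andP[_ /eqP ->] /andP[_ /eqP ->].
Qed.

Lemma clean_literal i i' x x' :
  pair_of i i' -> clean (w i ++ x) i ->
  eqv (w i ++ x) (w i' ++ x') <-> flip_eqv i x x'.
Proof.
move=> hp hc; split; last by apply: eqv_word_flip => //; left.
have ew k z : w k ++ z = head k ++ tl k ++ z by rewrite catA cat_head_tl.
rewrite !ew in hc * => /(clean_eqv hc)[[y' [/head_inj[<- <-] h]]|]; first by left.
move=> [k [y' [z [z' [hk /head_inj[<- <-] h h' hf]]]]].
have g : flip_eqv i x z by left.
apply: flip_eqv_transl g (flip_eqv_transl hf _).
by apply: (pair_of_cases hp); apply: eqv_sym.
Qed.

(** A remainder that does not literally begin with the tail can complete [w i] only by a rewriting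
    that involves a suffix of [tl i]; this ties the comparison to [tl i], and exchanging sides adds
    nothing. *)
Lemma same_side_eqv i y y' : clean (head i ++ y) i ->
  ~~ (prefix (tl i) y && prefix (tl i) y') ->
  eqv (head i ++ y) (head i ++ y') <-> eqv y y'.
Proof.
move=> hc hn; split; last exact: eqv_catl.
move=> /(clean_eqv hc)[[z [/head_inj[_ <-] //]]|].
move=> [k [z [x [x' [_ /head_inj[<- <-] h h' hf]]]]].
suff hz : zeqv i x x' by apply: eqv_trans h (eqv_trans hz (eqv_sym h')).
move: hn; case e: (prefix (tl i) y) => /=; last first.
  by move=> _; apply: flip_eqv_nonprefix e h hf.
move=> /negbTE e'; apply: eqv_sym.
exact: flip_eqv_nonprefix e' h' (flip_eqv_sym hf).
Qed.

Hypothesis bar_neq : forall i, bar i != i.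

Lemma other_side_eqv i y y' : clean (head i ++ y) i ->
  eqv (head i ++ y) (head (bar i) ++ y') <->
  exists x x', [/\ eqv y (tl i ++ x), eqv y' (tl (bar i) ++ x') &
    flip_eqv i x x'].
Proof.
move=> hc; split=> [/(clean_eqv hc)[[z [/head_inj[e _]]]|]|].
- by move: (bar_neq i); rewrite e eqxx.
- move=> [k [z [x [x' [_ /head_inj[<- <-] h h' hf]]]]].
  by exists x, x'.
move=> [x [x' [h h' hf]]]; apply: eqv_trans (eqv_catl _ h) _.
apply: eqv_trans _ (eqv_catl _ (eqv_sym h')).
by rewrite !catA !cat_head_tl; apply: eqv_word_flip hf; [left|right].
Qed.

Lemma other_side_eqv_l i x y' : clean (head i ++ tl i ++ x) i ->
  prefix (tl (bar i)) y' = false ->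
  eqv (head i ++ tl i ++ x) (head (bar i) ++ y') <-> eqv (tl (bar i) ++ x) y'.
Proof.
move=> hc hy; rewrite (other_side_eqv _ hc); split=> [[z [z' [h h' hf]]]|h].
  have hz : flip_eqv (bar i) x z'.
    apply: flip_eqv_bar; apply: flip_eqv_transl hf; by left.
  apply: eqv_trans (eqv_sym h').
  by apply/eqv_sym/(flip_eqv_nonprefix hy h')/flip_eqv_sym.
by exists x, x; split; [exact: eqv_refl|exact: eqv_sym|left; exact: eqv_refl].
Qed.

Lemma other_side_eqv_r i y x' : clean (head i ++ y) i ->
  prefix (tl i) y = false ->
  eqv (head i ++ y) (head (bar i) ++ tl (bar i) ++ x') <-> eqv y (tl i ++ x').
Proof.
move=> hc hy; rewrite (other_side_eqv _ hc); split=> [[z [z' [h h' hf]]]|h].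
  apply: (eqv_trans h); apply: (flip_eqv_nonprefix hy h).
  by apply: flip_eqv_transl hf _; right; apply: eqv_sym.
by exists x', x'; split=> //; [exact: eqv_refl|left; exact: eqv_refl].
Qed.

(* [drop (split_at i) (tl i)] is the longest common suffix of the two sides,
   truncated at length [L]. *)
Definition split_at i :=
  find (fun d => drop d (tl i) == drop d (tl (bar i))) (iota 0 L.+1).

Lemma split_atP i : split_at i <= L /\
  drop (split_at i) (tl i) = drop (split_at i) (tl (bar i)).
Proof.
have hh : has (fun d => drop d (tl i) == drop d (tl (bar i))) (iota 0 L.+1).
  apply/hasP; exists L; first by rewrite mem_iota add0n ltnS leqnn.
  by rewrite !drop_oversize ?size_tl.
have := nth_find 0 hh; have := hh; rewrite has_find size_iota => hl.
by rewrite nth_iota // add0n => /eqP.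
Qed.

Lemma split_at_min i d : drop d (tl i) = drop d (tl (bar i)) -> split_at i <= d.
Proof.
move=> h; rewrite leqNgt; apply/negP => hd.
have := before_find 0 hd; rewrite nth_iota ?add0n ?h ?eqxx //.
by have := (split_atP i).1; lia.
Qed.

(** * One comparison step, with a demanded prefix *)

Definition eqv_demand u v p := eqv u v /\ exists x, eqv u (p ++ x).

Lemma eqv_demand_nil u v : eqv_demand u v [::] <-> eqv u v.
Proof. by split=> [[]//|h]; split=> //; exists u; apply: eqv_refl. Qed.

(** Both tails take part in rewriting, through the same suffix [o]. Being common to both tails, [o]
    lies in their last [L - d] letters, so the first [d] letters of each tail are literally present.
    Behind them the words must be equivalent and able to show the common end of the tails. *)
Lemma other_side_neither i y y' : clean (head i ++ y) i ->
  prefix (tl i) y = false -> prefix (tl (bar i)) y' = false ->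
  let d := split_at i in
  eqv (head i ++ y) (head (bar i) ++ y') <->
  [/\ prefix (take d (tl i)) y, prefix (take d (tl (bar i))) y' &
    eqv_demand (drop d y) (drop d y') (drop d (tl i))].
Proof.
move=> hc hy hy' d; have [dL ed] := split_atP i; rewrite -/d in dL ed.
rewrite (other_side_eqv _ hc); split=> [[x [x' [h h' hf]]]|]; last first.
  move=> [/prefixP[z ey] /prefixP[z' ey']].
  rewrite ey ey' !drop_size_cat ?size_takel ?size_tl // => -[hz [x hx]].
  exists x, x; split; last by left; apply: eqv_refl.
    by rewrite -{2}(cat_take_drop d (tl i)) -catA; apply: eqv_catl.
  rewrite -{2}(cat_take_drop d (tl (bar i))) -catA -ed; apply: eqv_catl.
  exact: eqv_trans (eqv_sym hz) hx.
have hz := flip_eqv_nonprefix hy h hf.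
have [z [ o [k [t [e _ ey ht [oL ho]]]]]] := prefix_tl_eqv hy (eqv_trans h hz).
have [z' [ o' [k' [t' [e' _ ey' ht' [oL' ho']]]]]] := prefix_tl_eqv hy' h'.
have oo := straddle_uniq oL oL' ho ho'; subst o'.
have sz : size z' = size z.
  by apply: (@addIn (size o)); rewrite -!size_cat -e -e' !size_tl.
have dz : d <= size z by apply: split_at_min; rewrite e e' drop_size_cat // drop_size_cat.
have dz' : d <= size z' by rewrite sz.
have em : drop d z' = drop d z.
  move: ed; rewrite e e' !drop_catl // => /eqP; rewrite eqseq_cat ?size_drop ?sz //.
  by move=> /andP[/eqP].
rewrite e e' ey ey' !takel_cat // !drop_catl // em.
split; [by rewrite -{2}(cat_take_drop d z) -catA prefix_prefix| |].
  by rewrite -{2}(cat_take_drop d z') -catA prefix_prefix.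
split; last by exists x'; rewrite -catA; apply/eqv_catl/eqv_sym.
by apply: eqv_catl; apply: eqv_trans (eqv_sym ht) ht'.
Qed.

(** Every equivalent word starts with one of the two heads, both longer than [p]. The head of [i]
    does not start with [p], and the other one is reached only by completing [w i]. *)
Lemma clean_prefix i y p : clean (head i ++ y) i -> size p <= L ->
  prefix p (head i ++ y) = false ->
  (exists x, eqv (head i ++ y) (p ++ x)) <->
  prefix p (head (bar i)) /\ exists x, eqv y (tl i ++ x).
Proof.
move=> hc pL hp.
have sub k z t : p ++ z = head k ++ t -> prefix p (head k).
  move=> e; have := congr1 (take (size p)) e; rewrite take_size_cat //.
  by rewrite takel_cat; [move=> ->; apply: prefix_take|have := head_gt k; lia].
split=> [[x /(clean_eqv hc)[[z [/sub hz _]]|]]|[/prefixP[t et] [x hx]]].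
- by move: hp; rewrite prefix_catl.
- move=> [k [z [t [t' [hk /sub hz h _ _]]]]]; case: hk hz => -> hz.
    by move: hp; rewrite prefix_catl.
  by split=> //; exists t.
exists (t ++ tl (bar i) ++ x); rewrite catA -et.
apply: eqv_trans (eqv_catl _ hx) _; rewrite !catA !cat_head_tl.
exact: eqv_flip.
Qed.

(** For two words starting with full relation words: both are replaced by the same tail, chosen by
    [flip_eqv_dec]. *)
Definition drop_flip i i' x : bool + (seq A * nat * (seq A * nat) * seq A) :=
  let t := tl (if straddled i x then i else bar i) in
  inr ((t, size (w i)), (t, size (w i')), [::]).

(* Either an answer, or, for each word, an edit [(s, n)] putting [s] in place of
   its first [n] letters, together with the new demanded prefix. *)
Definition compare_step (u v p0 : seq A) : bool + (seq A * nat * (seq A * nat) * seq A) :=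
  let p := if prefix p0 u || prefix p0 v then [::] else p0 in
  if [pick i | clean u i] is Some i then
    let h := size (head i) in
    let y := drop h u in
    let ly := prefix (tl i) y in
    if prefix (head i) v then
      let ly' := prefix (tl i) (drop h v) in
      if (p == [::]) || prefix p (head (bar i)) then
        if ly && ly' then drop_flip i i (drop (size (w i)) u)
        else inr (([::], h), ([::], h),
                  if (p == [::]) || ly || ly' then [::] else tl i)
      else inl false
    else if prefix (head (bar i)) v && (p == [::]) then
      let h' := size (head (bar i)) in
      let y' := drop h' v in
      let ly' := prefix (tl (bar i)) y' in
      let d := split_at i in
      if ly && ly' then drop_flip i (bar i) (drop (size (w i)) u)
      else if ly then inr ((tl (bar i), size (w i)), ([::], h'), [::])
      else if ly' then inr (([::], h), (tl i, size (w (bar i))), [::])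
      else if prefix (take d (tl i)) y && prefix (take d (tl (bar i))) y' then
        inr (([::], h + d), ([::], h' + d), drop d (tl i))
      else inl false
    else inl false
  else
    match u, v with
    | [::], [::] => inl (p == [::])
    | a :: _, b :: _ =>
        if (a == b) && ((p == [::]) || (ohead p == Some a))
        then inr (([::], 1), ([::], 1), behead p) else inl false
    | _, _ => inl false
    end.

(** The strict decrease of the total length makes the number of steps linear; the bound on [p']
    keeps the demand within a finite state. *)
Definition compare_step_spec u v p (r : bool + (seq A * nat * (seq A * nat) * seq A)) :=
  match r with
  | inl b => b <-> eqv_demand u v p
  | inr (e, e', p') =>
      [/\ sound_edit u e && sound_edit v e', size e.1 + size e'.1 < e.2 + e'.2,
          size p' <= L &
          eqv_demand u v p <-> eqv_demand (apply_edit e u) (apply_edit e' v) p']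
  end.

Lemma eqv_demand_prefix u v p : prefix p u || prefix p v ->
  eqv_demand u v p <-> eqv_demand u v [::].
Proof.
move=> h; rewrite eqv_demand_nil; split=> [[]//|huv]; split=> //.
by case/orP: h => /prefixP[x e]; exists x; rewrite -e //; apply: eqv_refl.
Qed.

Lemma compare_step_spec_iff u v p p' r : eqv_demand u v p <-> eqv_demand u v p' ->
  compare_step_spec u v p r -> compare_step_spec u v p' r.
Proof.
move=> h; case: r => [b|[[e e'] q]] /=; first by rewrite h.
by move=> [h1 h2 h3]; rewrite h.
Qed.

Lemma drop_flip_spec i i' x x' p : pair_of i i' -> clean (w i ++ x) i ->
  (eqv_demand (w i ++ x) (w i' ++ x') p <-> eqv (w i ++ x) (w i' ++ x')) ->
  compare_step_spec (w i ++ x) (w i' ++ x') p (drop_flip i i' x).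
Proof.
move=> hp hc hD; have hi := size_w i; have hi' := size_w i'.
rewrite /drop_flip /=; split.
- by rewrite /sound_edit /= !size_cat !size_tl; lia.
- by rewrite /= !size_tl; lia.
- by [].
- rewrite hD (clean_literal _ hp hc) flip_eqv_dec eqv_demand_nil /apply_edit /=.
  by rewrite !drop_size_cat.
Qed.

Lemma compare_step_correct u v p0 : size p0 <= L ->
  compare_step_spec u v p0 (compare_step u v p0).
Proof.
move=> p0L; rewrite /compare_step.
(* A demand already met by one of the words is dropped; what remains is empty or a prefix of
   neither. *)
set p := if _ then _ else _.
have pL : size p <= L by rewrite /p; case: ifP.
have hp : p = [::] \/ prefix p u = false /\ prefix p v = false.
  by rewrite /p; case: ifPn => [|/norP[/negbTE ? /negbTE ?]]; [left|right].
have hD : eqv_demand u v p <-> eqv_demand u v p0.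
  by rewrite /p; case: ifP => // h; rewrite (eqv_demand_prefix h).
clearbody p; apply: (compare_step_spec_iff hD) => {p0 p0L hD}.
(* Without a clean head the first letter is fixed, so words and demand are consumed letter by
   letter. *)
case: pickP => [i hc|hn]; last first.
  have np : forall i z, ~ eqv u (w i ++ z).
    by apply: unclean_no_pivot => i; rewrite hn.
  have inv : eqv_demand u v p -> (u = [::] /\ v = [::]) \/
      (exists a u1 v1, [/\ u = a :: u1, v = a :: v1 & eqv u1 v1]).
    by move=> [h _]; apply: eqv_strip1 np h.
  case: u v inv np {hn} hp => [|a u] [|b v] inv np hp.
  - split=> [/eqP->|[_ [x hx]]]; first by apply/eqv_demand_nil; exact: eqv_refl.
    have [[_ e]|[? [? [? []//]]]] := eqv_strip1 np hx.
    by case: (p) e.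
  - by split=> // /inv[[]//|[? [? [? []]]]].
  - by split=> // /inv[[]//|[? [? [? []]]]].
  - case: ifP => [/andP[/eqP<- hpa]|hab] /=; last first.
      split=> // -[huv [x hx]]; move: hab.
      have [[]//|[? [? [? [[<- _] [-> _] _]]]]] := eqv_strip1 np huv.
      rewrite eqxx; have [[]//|[c [? [? [[<- _] e _]]]]] := eqv_strip1 np hx.
      by case: (p) e => [//|c' q] /= [-> _]; rewrite eqxx.
    rewrite /sound_edit /apply_edit /= !drop0; split=> //; first by case: (p) pL => //= *; lia.
    split=> [[huv [x hx]]|[huv [x hx]]].
      have [[]//|[? [? [? [[_ <-] [_ <-] h]]]]] := eqv_strip1 np huv.
      split=> //; have [[]//|[c [? [? [[<- <-] e h']]]]] := eqv_strip1 np hx.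
      move: e; case: (p) => [_|c' q /= [_ et]]; last by exists x; rewrite et.
      by exists u; apply: eqv_refl.
    split; first exact: (eqv_catl [:: a]).
    move: hpa hx; case: (p) => [_ _|c q /= /eqP[->] hx].
      by exists (a :: u); apply: eqv_refl.
    by exists x; apply: (eqv_catl [:: a]).
have /cleanP[] := hc; rewrite /head_at drop0 => /prefixP[y eu] _.
have dh k z : drop (size (head k)) (head k ++ z) = z by apply: drop_size_cat.
move: hc hp; rewrite {}eu => hc hp; rewrite dh.
have hhi := head_gt i; have hwi := size_w i; have hwb := size_w (bar i).
have hpx := clean_prefix hc pL.
have sw k : size (w k) = size (head k) + size (tl k).
  by rewrite -size_cat cat_head_tl.
have ecat k z : w k ++ z = head k ++ tl k ++ z by rewrite catA cat_head_tl.
case: ifPn => [/prefixP[y' ev]|hv].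
  move: hp; rewrite {}ev => hp; rewrite !dh.
  case: ifPn => [hg|/norP[/eqP p0 /negP hpb]]; last first.
    by split=> // -[_ hx]; case: hp => [//|[hp _]]; move/(hpx hp): hx => [].
  (* By [clean_prefix], an open demand only asks that [y] can complete [w i]. *)
  have hD : eqv_demand (head i ++ y) (head i ++ y') p <->
      eqv (head i ++ y) (head i ++ y') /\ (p = [::] \/ exists x, eqv y (tl i ++ x)).
    case: hp => [->|[hp _]].
      by rewrite eqv_demand_nil; split=> [h|[]//]; split=> //; left.
    split=> -[h hx]; split=> //; first by right; move/(hpx hp): hx => [].
    apply/(hpx hp); case: hx => [e|hx]; first by move: hp; rewrite e prefix0s.
    split=> //; case/orP: hg => [/eqP e|//]; by move: hp; rewrite e prefix0s.
  case: ifPn => [/andP[/prefixP[x ex] /prefixP[x' ex']]|hl].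
    have hD' : eqv_demand (head i ++ y) (head i ++ y') p <->
        eqv (head i ++ y) (head i ++ y').
      rewrite hD; split=> [[]//|h]; split=> //; right.
      by exists x; rewrite ex; apply: eqv_refl.
    rewrite ex ex' -!ecat in hD' hc *; rewrite drop_size_cat //.
    by apply: drop_flip_spec => //; left.
  rewrite /= /sound_edit /apply_edit /= !size_cat !leq_addr !dh; split=> //; first by lia.
    by case: ifP; rewrite // size_tl.
  rewrite hD (same_side_eqv hc hl); case: ifPn => [hp'|].
    rewrite eqv_demand_nil; split=> [[]//|h]; split=> //.
    case/orP: hp' => [/orP[/eqP->|/prefixP[x ex]]|/prefixP[x ex]]; first by left.
      by right; exists x; rewrite ex; apply: eqv_refl.
    by right; exists x; rewrite -ex.
  move=> /norP[/norP[/eqP p0 _] _]; split=> -[h hx]; split=> //; last by right.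
  by case: hx.
case: ifPn => [/andP[/prefixP[y' ev] /eqP ep]|hv'].
  move: hp hpx hv; rewrite ev ep => _ _ _; rewrite !dh.
  case: ifPn => [/andP[/prefixP[x ex] /prefixP[x' ex']]|hl].
    rewrite ex ex' -!ecat in hc *; rewrite drop_size_cat //.
    by apply: drop_flip_spec (eqv_demand_nil _ _) => //; right.
  case: ifPn => [/prefixP[x ex]|/negbTE hy].
    have hy' : prefix (tl (bar i)) y' = false.
      by apply: negbTE; move: hl; rewrite ex prefix_prefix.
    rewrite /= /sound_edit /apply_edit /= ex in hc *; split.
    - by rewrite -!ecat !size_cat !size_tl !leq_addr; lia.
    - by rewrite size_tl; have := head_gt (bar i); lia.
    - by [].
    rewrite !eqv_demand_nil (other_side_eqv_l hc hy') dh -ecat.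
    by rewrite (drop_size_cat _ (erefl (size (w i)))).
  case: ifPn => [/prefixP[x' ex]|/negbTE hy'].
    rewrite /= /sound_edit /apply_edit /= ex in hc *; split.
    - by rewrite -!ecat !size_cat !size_tl !leq_addr; lia.
    - by rewrite size_tl; lia.
    - by [].
    rewrite !eqv_demand_nil (other_side_eqv_r _ hc hy) dh -ecat.
    by rewrite (drop_size_cat _ (erefl (size (w (bar i))))).
  have hn := other_side_neither hc hy hy'; have [dL _] := split_atP i.
  case: ifPn => [/andP[hz hz']|hz] /=; last first.
    rewrite eqv_demand_nil hn; split=> // -[h h' _]; move: hz; by rewrite h h'.
  have s1 : split_at i <= size y.
    by have := size_prefix hz; rewrite size_takel ?size_tl.
  have s2 : split_at i <= size y'.
    by have := size_prefix hz'; rewrite size_takel ?size_tl.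
  rewrite /sound_edit /apply_edit /=; split.
  - by rewrite !size_cat; lia.
  - by have := head_gt (bar i); lia.
  - by rewrite size_drop size_tl; lia.
  rewrite eqv_demand_nil hn addnC -drop_drop dh addnC -drop_drop dh.
  by split=> [[]|].
(* Equivalence would make [v] start with one of the heads. For the other head, an open demand is a
   prefix of it, hence of [v], contrary to [hp]. *)
split=> // -[huv [x hx]]; exfalso; case: (clean_eqv hc huv) => [[z [e _]]|].
  by move: hv; rewrite e prefix_prefix.
move=> [k [z [_ [_ [hk e _ _ _]]]]]; case: hk e => -> e.
  by move: hv; rewrite e prefix_prefix.
move: hv'; rewrite e prefix_prefix /= => hp0.
case: hp => [e0|[h1 h2]]; first by rewrite e0 in hp0.
have [h3 _] := (hpx h1).1 (ex_intro _ x hx).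
by move: h2; rewrite e prefix_catl.
Qed.

(** * Locality of the comparison step *)

Lemma prefix_take_long (s : seq A) m u : size s <= m -> prefix s (take m u) = prefix s u.
Proof. by move=> sm; rewrite !prefixE take_takel. Qed.

Lemma prefix_drop_take (s : seq A) n m u : n + size s <= m ->
  prefix s (drop n (take m u)) = prefix s (drop n u).
Proof.
move=> h; rewrite -(subnKC (leq_trans (leq_addr _ _) h)) addnC -take_drop.
by apply: prefix_take_long; lia.
Qed.

Lemma cat_drop_take (s u : seq A) n m : n <= m ->
  s ++ drop n (take m u) = take (size s + (m - n)) (s ++ drop n u).
Proof.
move=> nm; rewrite take_cat ltnNge leq_addr /= addKn take_drop.
by rewrite subnK.
Qed.

Section Locality.
Variables (N B : nat).
Hypothesis size_w_le : forall i, size (w i) <= N.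
Hypothesis B_ge : 2 * N <= B.
Hypothesis L_le_B : L <= B.

Lemma head_at_take u m p j : p + N <= m -> head_at (take m u) p j = head_at u p j.
Proof.
move=> h; apply: prefix_drop_take; rewrite size_head.
by have := size_w_le j; lia.
Qed.

(** A head starting inside the front head ends before position [2 * N], which [B] covers. *)
Lemma clean_take u i : clean (take B u) i = clean u i.
Proof.
rewrite /clean head_at_take; last by lia.
congr andb; apply: eq_in_all => p; rewrite mem_iota => hp.
apply: eq_forallb => j; rewrite head_at_take //.
by move: hp; rewrite size_head; have := size_w_le i; lia.
Qed.

Lemma straddled_take i u :
  straddled i (drop (size (w i)) (take B u)) = straddled i (drop (size (w i)) u).
Proof.
apply: eq_in_has => p; rewrite mem_iota => hp; apply: eq_existsb => j.
have hi := size_w_le i.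
rewrite cat_drop_take ?head_at_take //; last by lia.
by rewrite size_tl; lia.
Qed.

Lemma compare_step_take u v p : size p <= L ->
  compare_step (take B u) (take B v) p = compare_step u v p.
Proof.
move=> pL; have hN i := size_w_le i; have hh i := head_gt i.
have sh i : size (head i) + L = size (w i).
  by have := congr1 size (cat_head_tl i); rewrite size_cat size_tl.
have pB := leq_trans pL L_le_B; have B0 := leq_trans L_gt0 L_le_B.
case e: [pick i | clean u i] => [i|]; rewrite /compare_step (eq_pick (clean_take u)) e.
  rewrite /drop_flip !straddled_take.
  have ph k x : prefix (head k) (take B x) = prefix (head k) x.
    by apply: prefix_take_long; have := hN k; have := sh k; lia.
  have pt k l x : prefix (tl k) (drop (size (head l)) (take B x)) =
      prefix (tl k) (drop (size (head l)) x).
    by apply: prefix_drop_take; rewrite size_tl; have := hN l; have := sh l; lia.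
  have ptt d k l x : prefix (take d (tl k)) (drop (size (head l)) (take B x)) =
      prefix (take d (tl k)) (drop (size (head l)) x).
    apply: prefix_drop_take; rewrite size_take_min size_tl.
    by have := hN l; have := sh l; lia.
  by rewrite !ph !pt !ptt !(prefix_take_long _ pB).
rewrite !(prefix_take_long _ pB).
by case: B B0 => // B' _; case: (u) (v) => [|a u'] [|b v'].
Qed.
End Locality.

End Rewriting.

(** * Buffered machines *)

Section BufferedMachine.
Variables (A : finType) (B L : nat).
Notation edit := (seq A * nat)%type.
Variable compare_step : seq A -> seq A -> seq A -> bool + (edit * edit * seq A).
Variable Spec : seq A -> seq A -> seq A -> Prop.
Hypothesis step_ok : forall u v p, size p <= L ->
  match compare_step u v p with
  | inl b => b <-> Spec u v p
  | inr (e, e', p') =>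
      [/\ sound_edit u e && sound_edit v e', size e.1 + size e'.1 < e.2 + e'.2,
          size p' <= L & Spec u v p <-> Spec (apply_edit e u) (apply_edit e' v) p']
  end.
Hypothesis step_local : forall u v p, size p <= L ->
  compare_step (take B u) (take B v) p = compare_step u v p.

(** While running: the buffered prefixes of both words, the demanded prefix, and for each input a
    flag that its end has been seen. The right summand is the answer. *)
Definition buffer_state : finType :=
  ((B.-bseq A * B.-bseq A * L.-bseq A * bool * bool) + bool)%type.

Definition read_symbol (k : nat) (s : {ffun 'I_2 -> option (A + void)}) i :=
  (s i, if val i == k then MoveRight else Stay).

Definition keep_symbol (s : {ffun 'I_2 -> option (A + void)}) (i : 'I_2) :=
  (s i, Stay).

Definition buffer_trans (q : buffer_state) (s : {ffun 'I_2 -> option (A + void)}) :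
    buffer_state * ('I_2 -> option (A + void) * head_move) :=
  match q with
  | inr b => (q, keep_symbol s)
  | inl (bu, bv, p, eu, ev) =>
      if ~~ eu && (size bu < B) then
        if s ord0 is Some (inl a)
        then (inl (insub_bseq B (rcons bu a), bv, p, eu, ev), read_symbol 0 s)
        else (inl (bu, bv, p, true, ev), keep_symbol s)
      else if ~~ ev && (size bv < B) then
        if s ord_max is Some (inl a)
        then (inl (bu, insub_bseq B (rcons bv a), p, eu, ev), read_symbol 1 s)
        else (inl (bu, bv, p, eu, true), keep_symbol s)
      else match compare_step bu bv p with
      | inl b => (inr b, keep_symbol s)
      | inr (e, e', p') =>
          (inl (insub_bseq B (apply_edit e bu), insub_bseq B (apply_edit e' bv),
                insub_bseq L p', eu, ev), keep_symbol s)
      end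
  end.

Definition buffer_machine : turing_machine A :=
  @TuringMachine A 0 void buffer_state
    (inl ([bseq], [bseq], [bseq], false, false))
    (fun q => if q is inr b then Some b else None) buffer_trans.

(** [r] is the unread input; the cells to the left are arbitrary, as the heads never move back. *)
Definition holds (t : tape (A + void)) (r : seq A) : Prop :=
  exists l, t = Tape l (ohead (map inl r)) (map Some (behead (map inl r))).

Lemma holds_stay t r : holds t r -> holds (tape_update t (tape_cur t, Stay)) r.
Proof. by move=> [l ->]; exists l. Qed.

Lemma holds_right t a r :
  holds t (a :: r) -> holds (tape_update t (tape_cur t, MoveRight)) r.
Proof. by move=> [l ->]; exists (Some (inl a) :: l); case: r. Qed.

Lemma val_insub_bseq n (s : seq A) : size s <= n -> insub_bseq n s = s :> seq A.
Proof. by move=> h; apply: insubdK. Qed.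

Lemma iter_step_halted n c b : tm_verdict c.1 = Some b ->
  iter n (@tm_step _ buffer_machine) c = c.
Proof. by move=> hc; elim: n => //= n ->; rewrite /tm_step hc. Qed.

Lemma take_cat_buffer (b r : seq A) : size b <= B -> (size b < B -> r = [::]) ->
  take B (b ++ r) = b.
Proof.
move=> bB hr; have [lt|ge] := ltnP (size b) B.
  by rewrite hr // cats0 take_oversize // ltnW.
by rewrite take_size_cat //; apply/eqP; rewrite eqn_leq ge bB.
Qed.

Lemma apply_edit_cat e (b r : seq A) : sound_edit b e ->
  apply_edit e (b ++ r) = apply_edit e b ++ r.
Proof. by move=> /andP[_ h]; rewrite /apply_edit drop_catl // catA. Qed.

Lemma size_apply_edit e (b : seq A) : sound_edit b e ->
  size (apply_edit e b) = size b + size e.1 - e.2.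
Proof. by move=> /andP[_ h]; rewrite /apply_edit size_cat size_drop addnBA // addnC. Qed.

(** A potential lowered by every step: reading takes a letter from weight 2 to weight 1, an edit
    shortens the buffers, meeting the end of an input sets a flag. The successor pays for the final
    answer. *)
Definition run_time (bu bv ru rv : seq A) (eu ev : bool) :=
  (2 * size ru + 2 * size rv + size bu + size bv + ~~ eu + ~~ ev).+1.

Lemma buffer_run n (bu bv : B.-bseq A) (p : L.-bseq A) eu ev ts ru rv :
  run_time bu bv ru rv eu ev <= n -> holds (ts ord0) ru -> holds (ts ord_max) rv ->
  (eu -> ru = [::]) -> (ev -> rv = [::]) ->
  exists b : bool,
    tm_verdict (iter n (@tm_step _ buffer_machine)
      ((inl (bu, bv, p, eu, ev) : buffer_state), ts)).1 = Some b /\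
    (b <-> Spec (bu ++ ru) (bv ++ rv) p).
Proof.
elim: n bu bv p eu ev ts ru rv => [//|n IH] bu bv p eu ev ts ru rv ht hu hv hru hrv.
rewrite iterSr {2}/tm_step /= /run_time ltnS in ht *.
rewrite ffunE; case: ifPn => [/andP[neu sb]|hbu].
  case: ru ht hu hru => [|a ru] ht hu hru.
    have -> : tape_cur (ts ord0) = None by case: hu => l ->.
    rewrite /=; apply: IH => //.
    - by move: ht; rewrite /run_time neu /=; lia.
    - by rewrite /keep_symbol ffunE; apply: holds_stay.
    - by rewrite /keep_symbol ffunE; apply: holds_stay.
  have -> : tape_cur (ts ord0) = Some (inl a) by case: hu => l ->.
  have e : insub_bseq B (rcons bu a) = rcons bu a :> seq A.
    by rewrite val_insub_bseq // size_rcons.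
  have IH' ts' := IH (insub_bseq B (rcons bu a)) bv p eu ev ts' ru rv.
  rewrite e cat_rcons in IH'; apply: IH' => //.
  - by move: ht; rewrite /run_time size_rcons /=; lia.
  - by rewrite /read_symbol ffunE; apply: holds_right hu.
  - by rewrite /read_symbol ffunE; apply: holds_stay.
  - by move=> heu; rewrite heu in neu.
rewrite ffunE; case: ifPn => [/andP[nev sb]|hbv].
  case: rv ht hv hrv => [|a rv] ht hv hrv.
    have -> : tape_cur (ts ord_max) = None by case: hv => l ->.
    rewrite /=; apply: IH => //.
    - by move: ht; rewrite /run_time nev /=; lia.
    - by rewrite /keep_symbol ffunE; apply: holds_stay.
    - by rewrite /keep_symbol ffunE; apply: holds_stay.
  have -> : tape_cur (ts ord_max) = Some (inl a) by case: hv => l ->.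
  have e : insub_bseq B (rcons bv a) = rcons bv a :> seq A.
    by rewrite val_insub_bseq // size_rcons.
  have IH' ts' := IH bu (insub_bseq B (rcons bv a)) p eu ev ts' ru rv.
  rewrite e cat_rcons in IH'; apply: IH' => //.
  - by move: ht; rewrite /run_time size_rcons /=; lia.
  - by rewrite /read_symbol ffunE; apply: holds_stay.
  - by rewrite /read_symbol ffunE; apply: holds_right hv.
  - by move=> hev; rewrite hev in nev.
(* Each buffer is now full or its input is exhausted, so it is exactly the part of the word that
   [step_local] looks at. *)
have eu_ : take B (bu ++ ru) = bu.
  apply: take_cat_buffer; first exact: size_bseq.
  by move=> h; apply: hru; move: hbu; rewrite h andbT negbK.
have ev_ : take B (bv ++ rv) = bv.
  apply: take_cat_buffer; first exact: size_bseq.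
  by move=> h; apply: hrv; move: hbv; rewrite h andbT negbK.
(* The effect on [Spec] is needed for the whole words, soundness of the edits for the buffers
   alone. *)
have := step_ok (bu ++ ru) (bv ++ rv) (size_bseq p).
have := step_ok bu bv (size_bseq p).
rewrite -(step_local (bu ++ ru) _ (size_bseq p)) eu_ ev_.
case: (compare_step bu bv p) => [b _ hb|[[e e'] p'] [/andP[se se'] he hp' _]].
  by exists b; rewrite (@iter_step_halted _ _ b).
rewrite !apply_edit_cat // => -[_ _ _ hD].
have sz x (b : B.-bseq A) : sound_edit b x -> size (apply_edit x b) <= B.
  by move=> h; rewrite size_apply_edit //; move: h (size_bseq b) => /andP[]; lia.
have e1 : insub_bseq B (apply_edit e bu) = apply_edit e bu :> seq A.
  by rewrite val_insub_bseq ?sz.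
have e2 : insub_bseq B (apply_edit e' bv) = apply_edit e' bv :> seq A.
  by rewrite val_insub_bseq ?sz.
have e3 : insub_bseq L p' = p' :> seq A by rewrite val_insub_bseq.
have IH' ts' := IH (insub_bseq B (apply_edit e bu)) (insub_bseq B (apply_edit e' bv))
  (insub_bseq L p') eu ev ts' ru rv.
rewrite e1 e2 e3 in IH'.
suff /IH' : run_time (apply_edit e bu) (apply_edit e' bv) ru rv eu ev <= n.
  move=> /(_ (fun i => tape_update (ts i)
    (keep_symbol [ffun i => tape_cur (ts i)] i))) [||//|//|b [hb hb']].
  - by rewrite /keep_symbol ffunE; apply: holds_stay.
  - by rewrite /keep_symbol ffunE; apply: holds_stay.
  by exists b; split; [exact: hb|rewrite hD].
move: ht; rewrite /run_time !size_apply_edit //.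
by move: se se' => /andP[? ?] /andP[? ?]; lia.
Qed.

Lemma buffer_linear_time : exists (M : turing_machine A) (c : nat), forall u v,
  exists b : bool,
    tm_answers_within M (c * (size u + size v + 1)) u v b /\ (b <-> Spec u v [::]).
Proof.
(* From empty buffers [run_time] is [2 * (size u + size v) + 3]. *)
exists buffer_machine, 3 => u v; apply: (@buffer_run _ [bseq] [bseq] [bseq]) => //.
- by rewrite /run_time /=; lia.
- by exists [::]; rewrite /= /tape_of_seq.
- by exists [::]; rewrite /= /tape_of_seq.
Qed.

End BufferedMachine.

(** * Counting presentations *)

Lemma onth_take (T : Type) (u : seq T) b s :
  s < b -> onth (take b u) s = onth u s.
Proof. by move=> sb; rewrite !onthE map_take nth_take. Qed.

Lemma onth_drop (T : Type) (u : seq T) n t : onth (drop n u) t = onth u (n + t).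
Proof. by rewrite !onthE map_drop nth_drop. Qed.

(* Pigeonhole with multiplicity: [J] independent modifications of each element
   of [B], each of which determines the element up to the choice of [k]. *)
Lemma card_cover_injective (T : choiceType) (J K : finType) (B S : set T)
    (Bk : K -> set T) (f : K -> T -> J -> T) :
  finite_set B -> finite_set S ->
  (forall x, B x -> exists k, Bk k x) ->
  (forall k x j, Bk k x -> S (f k x j)) ->
  (forall k x y i j, Bk k x -> Bk k y -> f k x i = f k y j -> x = y /\ i = j) ->
  (#|` fset_set B| * #|J| <= #|` fset_set S| * #|K|)%N.
Proof.
move=> finB finS cov fS finj.
have [kap kapP] : exists kap : fset_set B -> K, forall x, Bk (kap x) (val x).
  have inB (x : fset_set B) : exists k, Bk k (val x).
    by apply: cov; have := valP x; rewrite in_fset_set // inE.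
  by exists (fun x => projT1 (cid (inB x))) => x; case: cid.
have fmem (xj : fset_set B * J) :
    f (kap xj.1) (val xj.1) xj.2 \in fset_set S.
  by rewrite in_fset_set // inE; apply: fS.
pose g (xj : fset_set B * J) : fset_set S * K :=
  (FSetSub (fmem xj), kap xj.1).
rewrite !cardfE -!card_prod; apply: (@leq_card _ _ g) => -[x i] [y j] [].
move=> /= e ek; have hy := kapP y; rewrite -ek in e hy.
by have [/val_inj -> ->] := finj _ _ _ _ _ (kapP x) hy e.
Qed.

Lemma cube_le_exp m : 11 <= m -> m.+1 ^ 3 <= 2 ^ m.
Proof.
elim: m => // m IH; rewrite leq_eqVlt => /orP[/eqP <- //|]; rewrite ltnS => hm.
rewrite (expnS 2); have := IH hm; move: (2 ^ m) => c; rewrite !expnS expn0; nia.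
Qed.

Lemma square_le_exp_div c D : 0 < D ->
  exists n0, forall n, n0 <= n -> c * n.+1 ^ 2 <= 2 ^ (n %/ D).
Proof.
(* The threshold makes [n %/ D] at least [c * D ^ 2], which supplies the third factor of the cube;
   11 is where [cube_le_exp] starts. *)
move=> D0; exists ((c * D ^ 2 + 11) * D) => n hn; set m := n %/ D.
have hm : c * D ^ 2 + 11 <= m by rewrite leq_divRL.
have hD : n.+1 <= D * m.+1 by rewrite mulnC; apply: ltn_ceil.
apply: leq_trans (cube_le_exp _) => //; last by lia.
apply: (@leq_trans (c * (D * m.+1) ^ 2)); first by rewrite leq_mul2l leq_sqr hD orbT.
by rewrite expnMn mulnA [in leqRHS]expnS leq_mul2r; apply/orP; right; lia.
Qed.

(** * Families of words of length at least [m0] (0 for monoids, 1 for semigroups) *)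

Section Words.
Local Open Scope classical_set_scope.
Variables (T : choiceType) (I A : finType) (m0 : nat).
Variables (get : T -> I -> seq A) (make : (I -> seq A) -> T).
Hypothesis A_gt1 : 1 < #|A|.
Hypothesis I_gt0 : 0 < #|I|.
Hypothesis m0_le1 : m0 <= 1.
Hypothesis get_inj : forall P Q, get P =1 get Q -> P = Q.
Hypothesis get_make : forall f, (forall i, m0 <= size (f i)) -> get (make f) =1 f.
Hypothesis get_min : forall P i, m0 <= size (get P i).

Definition factors_unique L P := forall i j a b,
  a + L <= size (get P i) -> b + L <= size (get P j) ->
  (forall t, t < L -> onth (get P i) (a + t) = onth (get P j) (b + t)) ->
  i = j /\ a = b.

Definition long_words L P := forall i, 4 * L <= size (get P i).

Definition setw P i x : T := make (fun j => if j == i then x else get P j).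

Lemma get_setw P i x : m0 <= size x ->
  forall j, get (setw P i x) j = if j == i then x else get P j.
Proof. by move=> hx j; rewrite get_make // => l; case: eqP. Qed.

(** Within one word the second occurrence is the right one, so that its letters can be restored from
    left to right. *)
Definition repeats L (q : I * nat * I * nat) P :=
  let: (i, a, j, b) := q in
  [/\ a + L <= size (get P i), b + L <= size (get P j),
    (i != j) || (a < b) &
    forall t, t < L -> onth (get P i) (a + t) = onth (get P j) (b + t)].

Lemma not_factors_unique L P : ~ factors_unique L P -> exists q, repeats L q P.
Proof.
move=> h; apply: contrapT => hq; apply: h => i j a b ha hb hab.
have [ij|ij] := eqVneq i j; last first.
  by case: hq; exists (i, a, j, b); split=> //; rewrite ij.
split=> //; subst j; case: (ltngtP a b) => // lab; case: hq.
  by exists (i, a, i, b); split=> //; rewrite lab orbT.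
by exists (i, b, i, a); split=> //; [rewrite lab orbT|move=> t /hab].
Qed.

Definition overwrite (s x : seq A) b := take b s ++ x ++ drop (b + size x) s.

Lemma size_overwrite s x b : b + size x <= size s -> size (overwrite s x b) = size s.
Proof.
move=> h; rewrite /overwrite !size_cat size_takel; last exact: leq_trans (leq_addr _ _) h.
by rewrite size_drop addnA subnKC.
Qed.

Lemma overwrite_inj s s' x y b n : size x = n -> size y = n ->
  b + n <= size s -> b + n <= size s' -> overwrite s x b = overwrite s' y b ->
  [/\ x = y, take b s = take b s' & drop (b + n) s = drop (b + n) s'].
Proof.
move=> hx hy hs hs'; rewrite /overwrite hx hy => /eqP.
rewrite eqseq_cat; last first.
  by rewrite !size_takel // (leq_trans (leq_addr n _)).
by rewrite eqseq_cat ?hx ?hy // => /and3P[/eqP-> /eqP-> /eqP->].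
Qed.

(* The overwritten factor can be read off the other occurrence, letter by
   letter when the two occurrences overlap. *)
Lemma repeats_restore L i a j b P Q :
  repeats L (i, a, j, b) P -> repeats L (i, a, j, b) Q ->
  (forall l, l != j -> get P l = get Q l) ->
  take b (get P j) = take b (get Q j) ->
  drop (b + L) (get P j) = drop (b + L) (get Q j) -> get P j = get Q j.
Proof.
move=> [_ _ hij hP] [_ _ _ hQ] hl ht hd; apply: eq_from_onth => s.
elim/ltn_ind: s => s IH; have [sb|bs] := ltnP s b.
  by rewrite -(onth_take (get P j) sb) ht onth_take.
have [sL|Ls] := ltnP s (b + L); last first.
  by rewrite -(subnKC Ls) -!onth_drop hd.
rewrite -(subnKC bs) -hP -?hQ; [|lia..].
have [ij|/hl-> //] := eqVneq i j; subst j.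
by apply: IH; move: hij; rewrite eqxx /=; lia.
Qed.

Lemma leq_exp_word L : 2 ^ L <= #|A| ^ L.
Proof. by case: L => // L; rewrite leq_exp2r. Qed.

Variable S : set T.
Hypothesis S_finite : finite_set S.

(** The second occurrence is overwritten by any of the [#|A| ^ L] words of its length, and
    [repeats_restore] undoes this. The choice of two words and two positions gives the factor
    [(#|I| * n.+1) ^ 2]. *)
Lemma card_repeats L n :
  (forall P i, S P -> size (get P i) <= n) ->
  (forall P Q, (forall i, size (get P i) = size (get Q i)) -> S P -> S Q) ->
  #|` fset_set [set P | S P /\ ~ factors_unique L P]| * 2 ^ L <=
  #|` fset_set S| * (#|I| * n.+1) ^ 2.
Proof.
move=> S_le S_size; set B := [set P | _].
have finB : finite_set B by apply: sub_finite_set S_finite => P [].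
pose K : finType := (I * 'I_n.+1 * I * 'I_n.+1)%type.
pose q (k : K) := (k.1.1.1, val k.1.1.2, k.1.2, val k.2).
pose f (k : K) P (x : L.-tuple A) :=
  setw P k.1.2 (overwrite (get P k.1.2) x (val k.2)).
have fget k P (x : L.-tuple A) : repeats L (q k) P ->
    (forall j, get (f k P x) j = if j == k.1.2
       then overwrite (get P k.1.2) x (val k.2) else get P j) /\
    size (overwrite (get P k.1.2) x (val k.2)) = size (get P k.1.2).
  move=> [_ hb _ _]; have hs := @size_overwrite (get P k.1.2) x (val k.2).
  rewrite size_tuple in hs; rewrite hs //; split=> //.
  by apply: get_setw; rewrite hs.
have h := @card_cover_injective T (L.-tuple A) K B S
  (fun k P => B P /\ repeats L (q k) P) f finB S_finite.
have -> : (#|I| * n.+1) ^ 2 = #|K|.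
  by rewrite !card_prod !card_ord -mulnn; lia.
apply: leq_trans (h _ _ _) => {h}.
- by rewrite leq_mul2l card_tuple leq_exp_word orbT.
- move=> P BP; have [[[[i a] j] b] hq] := not_factors_unique BP.2.
  have [ha hb _ _] := hq; have hi := S_le P i BP.1; have hj := S_le P j BP.1.
  have an : a < n.+1 by lia.
  have bn : b < n.+1 by lia.
  by exists (i, Ordinal an, j, Ordinal bn).
- move=> k P x [BP hq]; apply: S_size BP.1 => i.
  by have [-> hs] := fget k P x hq; case: eqP => // ->.
move=> k P Q x y [_ hP] [_ hQ] e.
have [gP sP] := fget k P x hP; have [gQ sQ] := fget k Q y hQ.
have eg j := congr1 (fun R => get R j) e.
have [_ hbP _ _] := hP; have [_ hbQ _ _] := hQ.
have := eg k.1.2; rewrite gP gQ eqxx.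
move=> /(overwrite_inj (size_tuple x) (size_tuple y) hbP hbQ)[/val_inj-> e1 e2].
have el l : l != k.1.2 -> get P l = get Q l.
  by move=> hl; have := eg l; rewrite gP gQ (negbTE hl).
split=> //; apply: get_inj => l; have [->|/el//] := eqVneq l k.1.2.
exact: repeats_restore hP hQ el e1 e2.
Qed.

(* [4 L t] letters are moved from a longest word to the short one; the length of
   the latter then reveals [t]. *)
Lemma card_short_sum L N n :
  S = [set P | \sum_i size (get P i) = n] ->
  0 < L -> 0 < N -> (4 * L * N + 1) * #|I| <= n ->
  #|` fset_set [set P | S P /\ ~ long_words L P]| * N <=
  #|` fset_set S| * #|I| ^ 2.
Proof.
move=> S_def L0 N0 hn; set B := [set P | _].
have finB : finite_set B by apply: sub_finite_set S_finite => P [].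
pose Bk (k : I * I) P := [/\ B P, size (get P k.1) < 4 * L &
  n <= size (get P k.2) * #|I|].
pose g (k : I * I) P (t : 'I_N) l :=
  if l == k.1 then get P k.1 ++ take (4 * L * t) (get P k.2)
  else if l == k.2 then drop (4 * L * t) (get P k.2) else get P l.
have BkP k P (t : 'I_N) : Bk k P ->
    [/\ k.2 != k.1, 4 * L * t < size (get P k.2) & forall l, m0 <= size (g k P t l)].
  move=> [_ h1 h2]; have ht := ltn_ord t.
  (* With more than [4 * L * N] letters, the long word differs from the short one and stays
     non-empty after the largest move. *)
  have h3 : 4 * L * N + 1 <= size (get P k.2).
    by rewrite -(leq_pmul2r I_gt0); apply: leq_trans hn h2.
  have h4 : 4 * L * t + 4 * L <= 4 * L * N.
    by rewrite -mulnSr leq_mul2l ht orbT.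
  split; [|lia|].
    by apply/eqP => e; rewrite e in h3; nia.
  move=> l; rewrite /g; case: eqP => _.
    by rewrite size_cat; apply: leq_trans (get_min P k.1) (leq_addr _ _).
  by case: eqP => // _; rewrite size_drop; lia.
have eN : #|I| ^ 2 = #|{: I * I}| by rewrite card_prod mulnn.
rewrite eN -[X in _ * X <= _](card_ord N).
apply: (@card_cover_injective T _ _ B S Bk (fun k P t => make (g k P t))) => //.
- move=> P BP; have [i hi] : exists i, ~~ (4 * L <= size (get P i)).
    apply: contrapT => h; apply: BP.2 => i; apply: contrapT => /negP hi.
    by apply: h; exists i.
  have [j hj] : exists j, n <= size (get P j) * #|I|.
    have [j hj] := eq_bigmax (fun i => size (get P i)) I_gt0.
    exists j; have := BP.1; rewrite S_def /= => <-.
    rewrite mulnC -sum_nat_const; apply: leq_sum => l _.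
    by have := @leq_bigmax _ (fun i => size (get P i)) l; rewrite hj.
  by exists (i, j); split; rewrite //= ltnNge.
- move=> k P t hk; have [kk ht hg] := BkP k P t hk.
  have [[SP _] _ _] := hk; move: SP; rewrite S_def /= => <-.
  rewrite (bigD1 k.1) //= (bigD1 k.2) //= [in RHS](bigD1 k.1) //=.
  rewrite [X in _ = _ + X](bigD1 k.2) //= !(get_make hg) {1 2}/g !eqxx (negbTE kk).
  rewrite (eq_bigr (fun l => size (get P l))) => [|l /andP[h1 h2]]; last first.
    by rewrite get_make // /g (negbTE h1) (negbTE h2).
  rewrite size_cat size_drop size_takel; last exact: ltnW.
  by rewrite !addnA -(addnA (size _)) subnKC // ltnW.
move=> k P Q t t' hP hQ e; have [kk ht hg] := BkP k P t hP.
have [_ ht' hg'] := BkP k Q t' hQ.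
have eg l : g k P t l = g k Q t' l by rewrite -(get_make hg) -(get_make hg') e.
have [_ sP _] := hP; have [_ sQ _] := hQ.
have := eg k.1; have := eg k.2; rewrite /g !eqxx (negbTE kk) => ed ec.
have := congr1 size ec; rewrite !size_cat !size_takel ?(ltnW ht) ?(ltnW ht') // => es.
have tt : t = t' :> nat.
  move: es sP sQ; move: (size (get P k.1)) (size (get Q k.1)) => x y es sP sQ.
  case: (ltngtP t t') => // h; exfalso; nia.
have tt' := val_inj tt; subst t'; split=> //.
have : get P k.1 == get Q k.1 /\
    take (4 * L * t) (get P k.2) == take (4 * L * t) (get Q k.2).
  by apply/andP; rewrite -eqseq_cat; [apply/eqP|apply: (addIn es)].
move=> [/eqP e1 /eqP e2]; apply: get_inj => l.
have [->//|l1] := eqVneq l k.1; have [->|l2] := eqVneq l k.2.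
  by rewrite -(cat_take_drop (4 * L * t) (get P k.2)) e2 ed cat_take_drop.
by have := eg l; rewrite /g (negbTE l1) (negbTE l2).
Qed.

(** The prepended word can be read off, and the lengthened word stays below [n], so the maximum is
    still attained elsewhere. The resulting bound is weakened to the form obtained for the sum. *)
Lemma card_short_max L N n :
  S = [set P | \max_i size (get P i) = n] -> 4 * L + N <= n ->
  #|` fset_set [set P | S P /\ ~ long_words L P]| * N <=
  #|` fset_set S| * #|I| ^ 2.
Proof.
move=> S_def hn; set B := [set P | _].
have finB : finite_set B by apply: sub_finite_set S_finite => P [].
pose f (k : I) P (x : N.-tuple A) := setw P k (x ++ get P k).
have fget k P (x : N.-tuple A) j :
    get (f k P x) j = if j == k then x ++ get P k else get P j.
  by apply: get_setw; rewrite size_cat (leq_trans (get_min P k)) ?leq_addl.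
have h := @card_cover_injective T (N.-tuple A) I B S
  (fun k P => B P /\ size (get P k) < 4 * L) f finB S_finite.
apply: (@leq_trans (#|` fset_set B| * #|{: N.-tuple A}|)).
  rewrite leq_mul2l card_tuple; apply/orP; right.
  by apply: leq_trans (leq_exp_word N); apply/ltnW/ltn_expl.
apply: leq_trans (h _ _ _) _ => {h}.
- move=> P BP; apply: contrapT => hk; apply: BP.2 => i; rewrite leqNgt.
  by apply/negP => hi; apply: hk; exists i.
- move=> k P x [[SP _] hk]; move: SP; rewrite S_def /= => SP.
  have [j hj] := eq_bigmax (fun i => size (get P i)) I_gt0.
  have jk : j != k by apply/eqP => e; move: hj; rewrite SP e; lia.
  apply/eqP; rewrite eqn_leq; apply/andP; split.
    apply/bigmax_leqP => i _; rewrite fget; case: eqP => _.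
      by rewrite size_cat size_tuple; lia.
    by have := @leq_bigmax _ (fun i => size (get P i)) i; rewrite SP.
  rewrite -SP hj; have := @leq_bigmax _ (fun i => size (get (f k P x) i)) j.
  by rewrite fget (negbTE jk).
- move=> k P Q x y _ _ e; have eg j := congr1 (fun R => get R j) e.
  have := eg k; rewrite !fget eqxx => /eqP; rewrite eqseq_cat ?size_tuple //.
  move=> /andP[/eqP/val_inj-> /eqP ek]; split=> //; apply: get_inj => j.
  by have := eg j; rewrite !fget; case: eqP => // ->.
by rewrite leq_mul2l; apply/orP; right; rewrite -mulnn; apply: leq_pmulr.
Qed.

Definition good P := exists L, [/\ 0 < L, long_words L P & factors_unique L P].

(** A presentation that is not good fails for this [L] through a short word or a repeated factor,
    and for [e > 0] each class is at most a [1 / (2 * e)] fraction. *)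
Lemma card_bad L N n e :
  (forall P i, S P -> size (get P i) <= n) ->
  (forall P Q, (forall i, size (get P i) = size (get Q i)) -> S P -> S Q) ->
  #|` fset_set [set P | S P /\ ~ long_words L P]| * N <=
    #|` fset_set S| * #|I| ^ 2 ->
  0 < L -> 2 * e * #|I| ^ 2 <= N -> 2 * e * (#|I| * n.+1) ^ 2 <= 2 ^ L ->
  e * #|` fset_set (S `\` [set P | good P])| <= #|` fset_set S|.
Proof.
move=> S_le S_size hshort L0 hN hL; have hrep := card_repeats L S_le S_size.
set B1 := [set P | _] in hshort; set B2 := [set P | _] in hrep.
have fin1 : finite_set B1 by apply: sub_finite_set S_finite => P [].
have fin2 : finite_set B2 by apply: sub_finite_set S_finite => P [].
have hB : #|` fset_set (S `\` [set P | good P])| <=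
    #|` fset_set B1| + #|` fset_set B2|.
  apply: leq_trans (leq_card_fsetU _ _).1; rewrite -fset_setU //.
  apply: fsubset_leq_card; rewrite -fset_set_sub.
  - move=> P [SP nP]; have [hl|hl] := pselect (long_words L P); last by left.
    by right; split=> // hf; apply: nP; exists L.
  - by apply: sub_finite_set S_finite => P [].
  - by rewrite finite_setU.
have I2 : 0 < #|I| ^ 2 by rewrite expn_gt0 I_gt0.
have n2 : 0 < (#|I| * n.+1) ^ 2 by rewrite expn_gt0 muln_gt0 I_gt0.
move: (#|I| ^ 2) ((#|I| * n.+1) ^ 2) I2 n2 hshort hrep hN hL hB => a b a0 b0.
move: #|` _| #|` fset_set S| #|` fset_set B1| #|` fset_set B2| (2 ^ L).
move=> x s y z c h1 h2 h3 h4 h5.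
have k1 : 2 * e * y <= s.
  rewrite -(leq_pmul2r a0); apply: leq_trans h1; rewrite mulnAC mulnC.
  by rewrite leq_mul2l h3 orbT.
have k2 : 2 * e * z <= s.
  rewrite -(leq_pmul2r b0); apply: leq_trans h2; rewrite mulnAC mulnC.
  by rewrite leq_mul2l h4 orbT.
have : e * x <= e * (y + z) by rewrite leq_mul2l h5 orbT.
by rewrite mulnDr; lia.
Qed.

Lemma make_size (h : I -> nat) (a : A) : (forall i, m0 <= h i) ->
  forall i, size (get (make (fun i => nseq (h i) a)) i) = h i.
Proof. by move=> hh i; rewrite get_make ?size_nseq // => j; rewrite size_nseq. Qed.

End Words.

(** * Rarity of bad presentations in both stratifications *)

Section Strata.
Local Open Scope classical_set_scope.
Variables (T : choiceType) (I A : finType) (m0 : nat).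
Variables (get : T -> I -> seq A) (make : (I -> seq A) -> T).
Hypothesis A_gt1 : 1 < #|A|.
Hypothesis I_gt0 : 0 < #|I|.
Hypothesis m0_le1 : m0 <= 1.
Hypothesis get_inj : forall P Q, get P =1 get Q -> P = Q.
Hypothesis get_make : forall f, (forall i, m0 <= size (f i)) -> get (make f) =1 f.
Hypothesis get_min : forall P i, m0 <= size (get P i).

Lemma sum_stratum_bad e : exists n0, forall n, n0 <= n ->
  forall S : set T, finite_set S -> S = [set P | \sum_i size (get P i) = n] ->
  S !=set0 /\
  e * #|` fset_set (S `\` [set P | good get P])| <= #|` fset_set S|.
Proof.
(* With [L = n %/ D] positive, [(4 * L * N + 1) * #|I| <= D * L <= n]. The successor keeps [N]
   positive when [e = 0]. *)
set N := (2 * e * #|I| ^ 2).+1; set D := (4 * N + 1) * #|I|.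
have D0 : 0 < D by rewrite muln_gt0 I_gt0 addn1.
have [n1 hn1] := @square_le_exp_div (2 * e * #|I| ^ 2) D D0.
exists (n1 + D + #|I|) => n hn S finS S_def; split.
  have /card_gt0P[a _] : 0 < #|A| by apply: ltnW.
  have /card_gt0P[i0 _] := I_gt0.
  (* One word takes all letters left over by the minimal lengths of the others. *)
  exists (make (fun i => nseq (if i == i0 then n - #|I|.-1 * m0 else m0) a)).
  have hI : #|I|.-1 * m0 <= #|I|.-1 by rewrite -[leqRHS]muln1 leq_mul2l m0_le1 orbT.
  rewrite S_def /= (eq_bigr (fun i => if i == i0 then n - #|I|.-1 * m0 else m0)).
    rewrite (bigD1 i0) //= eqxx.
    rewrite (eq_bigr (fun => m0)) => [|i /negbTE->//].
    rewrite sum_nat_const cardC1 subnK //; apply: leq_trans hI _.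
    by apply: leq_trans (leq_pred _) _; apply: leq_trans hn; rewrite leq_addl.
  move=> i _; apply: (make_size get_make
    (h := fun i => if i == i0 then n - #|I|.-1 * m0 else m0)) => j.
  by case: eqP => // _; lia.
have hL : D * (n %/ D) <= n by rewrite mulnC leq_trunc_div.
have L0 : 0 < n %/ D by rewrite divn_gt0 //; lia.
apply: (card_bad A_gt1 I_gt0 m0_le1 get_inj get_make get_min finS (L := n %/ D)
  (N := N) (n := n)).
- by move=> P i; rewrite S_def /= => <-; rewrite (bigD1 i) //= leq_addr.
- by move=> P Q h; rewrite S_def /= => <-; apply: eq_bigr => i _; rewrite h.
- apply: (card_short_sum A_gt1 I_gt0 m0_le1 get_inj get_make get_min finS S_def) => //.
  move: (n %/ D) L0 hL => L L0; apply: leq_trans.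
  by rewrite /D [leqRHS]mulnAC leq_mul2r mulnDl mul1n (mulnAC 4) leq_add2l L0 orbT.
- by [].
- exact: leqnSn.
- by rewrite expnMn mulnA; apply: hn1; lia.
Qed.

Lemma max_stratum_bad e : exists n0, forall n, n0 <= n ->
  forall S : set T, finite_set S -> S = [set P | \max_i size (get P i) = n] ->
  S !=set0 /\
  e * #|` fset_set (S `\` [set P | good get P])| <= #|` fset_set S|.
Proof.
set N := (2 * e * #|I| ^ 2).+1.
(* With [L = n %/ 8], [4 * L] is at most half of [n], leaving room for [N] prepended letters. *)
have [n1 hn1] := @square_le_exp_div (2 * e * #|I| ^ 2) 8 isT.
exists (n1 + 2 * N + 8) => n hn S finS S_def; split.
  have /card_gt0P[a _] : 0 < #|A| by apply: ltnW.
  exists (make (fun i => nseq n a)); rewrite S_def /=.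
  have hs i : size (get (make (fun => nseq n a)) i) = n.
    by apply: (make_size get_make (h := fun => n)); lia.
  by have [i ->] := eq_bigmax (fun i => size (get (make (fun => nseq n a)) i)) I_gt0.
have hL : 8 * (n %/ 8) <= n by rewrite mulnC leq_trunc_div.
have L0 : 0 < n %/ 8 by rewrite divn_gt0 //; lia.
apply: (card_bad A_gt1 I_gt0 m0_le1 get_inj get_make get_min finS (L := n %/ 8)
  (N := N) (n := n)).
- by move=> P i; rewrite S_def /= => <-; apply: (@leq_bigmax _ (fun i => size (get P i))).
- by move=> P Q h; rewrite S_def /= => <-; apply: eq_bigr => i _; rewrite h.
- by apply: (card_short_max A_gt1 I_gt0 m0_le1 get_inj get_make get_min finS S_def); lia.
- by [].
- exact: leqnSn.
- by rewrite expnMn mulnA; apply: hn1; lia.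
Qed.

End Strata.

(** * Genericity as vanishing density of the complement *)

Section Genericity.
Import Order.TTheory GRing.Theory Num.Theory.
Local Open Scope classical_set_scope.

Lemma generic_criterion (R : realType) (T : choiceType) (S_ : nat -> set T) X :
  (forall n, finite_set (S_ n)) ->
  (forall e, exists n0, forall n, n0 <= n -> S_ n !=set0 /\
     e * #|` fset_set (S_ n `\` X)| <= #|` fset_set (S_ n)|) ->
  generic R S_ X.
Proof.
move=> finS h; apply/cvgrPdist_le => eps eps0.
(* Any [e] at least [1 / eps] will do, the complement having density at most [1 / e]. *)
have [n0 hn0] := h (Num.bound (eps^-1)%R).
exists n0 => // n /= /hn0[[P SP] hb].
have finX : finite_set (S_ n `&` X) by apply: sub_finite_set (finS n) => ? [].
have finD : finite_set (S_ n `\` X) by apply: sub_finite_set (finS n) => ? [].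
have s0 : 0 < #|` fset_set (S_ n)|.
  by rewrite cardfs_gt0; apply/fset0Pn; exists P; rewrite in_fset_set // inE.
have hs : #|` fset_set (X `&` S_ n)| + #|` fset_set (S_ n `\` X)| = #|` fset_set (S_ n)|.
  have -> : S_ n `\` X = S_ n `\` (X `&` S_ n).
    by rewrite setDIr setDv setU0.
  rewrite setIC fset_setD // -(cardfsID (fset_set (S_ n `&` X)) (fset_set (S_ n))).
  by rewrite -fset_setI // setIA setIid.
move: s0 hs; set x := #|` fset_set (X `&` _)|; set b := #|` fset_set (_ `\` _)| in hb *.
set s := #|` _| in hb * => s0 hs.
have sR : (0 < s%:R :> R)%R by rewrite ltr0n.
have -> : (1 - x%:R / s%:R = b%:R / s%:R :> R)%R.
  by apply/eqP; rewrite subr_eq -mulrDl -natrD addnC hs divff // lt0r_neq0.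
rewrite ger0_norm ?divr_ge0 // ler_pdivrMr //.
have hbound : (eps^-1 <= (Num.bound eps^-1)%:R)%R.
  by apply/ltW/archi_boundP; rewrite invr_ge0 ltW.
rewrite -ler_pdivrMl // mulrC; apply: (@le_trans _ _ ((Num.bound eps^-1)%:R * b%:R)%R).
  by rewrite mulrC ler_wpM2r.
by rewrite -natrM ler_nat.
Qed.

End Genericity.

(** * Presentations *)

Section Presentations.
Variables (A : finType) (k : nat).
Notation side_index := ('I_k * bool)%type.

Definition flip_side (i : side_index) : side_index := (i.1, ~~ i.2).

Lemma flip_sideK : involutive flip_side.
Proof. by case=> i b; rewrite /flip_side /= negbK. Qed.

Lemma flip_side_neq i : flip_side i != i.
Proof. by case: i => i [] /=; rewrite /flip_side xpair_eqE eqxx. Qed.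

Lemma eqv_linear_time (w : side_index -> seq A) :
  good (fun w => w) w ->
  exists (M : turing_machine A) (c : nat), forall u v, exists b : bool,
    tm_answers_within M (c * (size u + size v + 1)) u v b /\
    (b <-> eqv w flip_side u v).
Proof.
move=> [L [L0 hlen huniq]].
(* Locality needs room for the demanded prefix and for two relation words. *)
pose N := \max_i size (w i); pose B := L + 2 * N.
have hN i : size (w i) <= N by apply: (leq_bigmax (F := fun i => size (w i))).
have step_ok u v p : size p <= L ->
    compare_step_spec w flip_side L u v p (compare_step w flip_side L u v p).
  by apply: compare_step_correct => //; [exact: flip_sideK|exact: flip_side_neq].
have step_local u v p : size p <= L ->
    compare_step w flip_side L (take B u) (take B v) p = compare_step w flip_side L u v p.
  by apply: (compare_step_take _ L0 hlen hN (leq_addl _ _) (leq_addr _ _)).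
have [M [c h]] := buffer_linear_time step_ok step_local.
exists M, c => u v; have [b [hb hD]] := h u v; exists b; split=> //.
by rewrite hD eqv_demand_nil.
Qed.

(** * The generated congruence as rewriting between sides of relations *)

Definition side (W : Type) (P : k.-tuple (W * W)) (i : side_index) : W :=
  if i.2 then (tnth P i.1).2 else (tnth P i.1).1.

Lemma mem_side (W : eqType) (P : k.-tuple (W * W)) u v : (u, v) \in P ->
  exists i, u = side P i /\ v = side P (flip_side i).
Proof. by case/tnthP => i e; exists (i, false); rewrite /side /= -e. Qed.

Lemma side_mem (W : eqType) (P : k.-tuple (W * W)) i :
  (side P i, side P (flip_side i)) \in P \/ (side P (flip_side i), side P i) \in P.
Proof.
by case: i => i []; [right|left]; rewrite /side /= -surjective_pairing mem_tnth.
Qed.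

Lemma eqv_congruence (W : eqType) (mul : W -> W -> W) (word : W -> seq A)
    (P : k.-tuple (W * W)) u v :
  {morph word : x y / mul x y >-> x ++ y} ->
  congruence_gen mul (fun u v => (u, v) \in P) u v ->
  eqv (word \o side P) flip_side (word u) (word v).
Proof.
move=> wordM; elim=> {u v} [u v /mem_side[i [-> ->]]|u|u v _|u v x _ h _|u u' v v' _ h _ h'].
- by have := eqv_flip (word \o side P) flip_side i [::]; rewrite !cats0.
- exact: eqv_refl.
- exact/eqv_sym/flip_sideK.
- exact: eqv_trans.
- by rewrite !wordM; apply: eqv_cat.
Qed.

Lemma cg_side (W : eqType) (mul : W -> W -> W) (P : k.-tuple (W * W)) i :
  congruence_gen mul (fun u v => (u, v) \in P) (side P i) (side P (flip_side i)).
Proof. by case: (side_mem P i) => h; [|apply: cg_sym]; apply: cg_rel. Qed.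

Lemma monoid_equivE (P : monoid_pres A k) u v :
  monoid_equiv P u v <-> eqv (side P) flip_side u v.
Proof.
split; first exact: (@eqv_congruence _ _ id).
move=> [n]; elim=> [x|{}n x y z _ IH [a [i [b [ey ez]]]]]; first exact: cg_refl.
apply: cg_trans IH _; rewrite ey ez; apply: cg_mul; first exact: cg_refl.
by apply: cg_mul; [exact: cg_side|exact: cg_refl].
Qed.

(** The free semigroup has no identity to multiply with, so empty contexts need cases of their
    own. *)
Lemma semigroup_equiv_context (P : semigroup_pres A k) a b s t s' t' :
  semigroup_equiv P s t -> val s' = a ++ val s ++ b -> val t' = a ++ val t ++ b ->
  semigroup_equiv P s' t'.
Proof.
have right_ctx y x z x' z' : semigroup_equiv P x z -> val x' = val x ++ y ->
    val z' = val z ++ y -> semigroup_equiv P x' z'.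
  case: y => [|c y] h; first by rewrite !cats0 => /val_inj-> /val_inj->.
  move=> ex ez; pose y' : neword A := exist _ (c :: y) isT.
  have -> : x' = neword_cat x y' by apply: val_inj.
  have -> : z' = neword_cat z y' by apply: val_inj.
  by apply: cg_mul => //; apply: cg_refl.
case: a => [|c a] h; first exact: right_ctx.
pose a' : neword A := exist _ (c :: a) isT.
rewrite !catA => es et; apply: (right_ctx b (neword_cat a' s) (neword_cat a' t)) => //.
by apply: cg_mul => //; apply: cg_refl.
Qed.

(** For the converse, a derivation among all words that starts from a non-empty one never meets the
    empty word, since relation words are non-empty. *)
Lemma semigroup_equivE (P : semigroup_pres A k) u v :
  semigroup_equiv P u v <-> eqv (val \o side P) flip_side (val u) (val v).
Proof.
split; first exact: (@eqv_congruence _ _ val).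
suff main n x y : rewrites (val \o side P) flip_side n x y -> x = val u ->
    exists2 y' : neword A, val y' = y & semigroup_equiv P u y'.
  by move=> [n /main/(_ erefl)[v' /val_inj->]].
elim=> [z ->|{}n {}x z t _ IH [a [i [b [ez et]]]] /IH[z' hz h]].
  by exists u => //; apply: cg_refl.
have ht : t != [::].
  by rewrite et -size_eq0 !size_cat /=; case: (side P (flip_side i)) => -[|c s] //= _; lia.
exists (exist _ t ht) => //; apply: cg_trans h _.
apply: semigroup_equiv_context (cg_side _ P i) _ _; first by rewrite hz ez.
by [].
Qed.

Lemma good_monoid_linear (P : monoid_pres A k) :
  good (@side (seq A)) P -> monoid_wp_linear_time P.
Proof.
move=> hP; have [M [c h]] := @eqv_linear_time (side P) hP.
by exists M, c => u v; have [b [hb hE]] := h u v; exists b; rewrite monoid_equivE.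
Qed.

Lemma good_semigroup_linear (P : semigroup_pres A k) :
  good (fun P => val \o @side (neword A) P) P -> semigroup_wp_linear_time P.
Proof.
move=> hP; have [M [c h]] := @eqv_linear_time (val \o side P) hP.
exists M, c => u v; have [b [hb hE]] := h (val u) (val v); exists b.
by rewrite semigroup_equivE.
Qed.

Lemma sum_length_side (W : Type) (len : W -> nat) (P : k.-tuple (W * W)) :
  sum_length len P = \sum_i len (side P i).
Proof.
rewrite /sum_length big_tuple (eq_bigl (fun i => true && true)) // -(pair_big xpredT xpredT
  (fun i b => len (side P (i, b)))) /=.
by apply: eq_bigr => i _; rewrite big_bool addnC.
Qed.

Lemma max_length_side (W : Type) (len : W -> nat) (P : k.-tuple (W * W)) :
  max_length len P = \max_i len (side P i).
Proof.
rewrite /max_length big_tuple (eq_bigl (fun i => true && true)) // -(pair_big xpredT xpredT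
  (fun i b => len (side P (i, b)))) /=.
by apply: eq_bigr => i _; rewrite big_bool maxnC.
Qed.

Lemma side_inj (W : Type) (P Q : k.-tuple (W * W)) : side P =1 side Q -> P = Q.
Proof.
move=> h; apply: eq_from_tnth => i; rewrite (surjective_pairing (tnth P i)).
rewrite (surjective_pairing (tnth Q i)).
by have := h (i, true); have := h (i, false); rewrite /side /= => -> ->.
Qed.

Definition of_sides (W : Type) (f : side_index -> W) : k.-tuple (W * W) :=
  [tuple (f (i, false), f (i, true)) | i < k].

Lemma side_of_sides (W : Type) (f : side_index -> W) : side (of_sides f) =1 f.
Proof. by case=> i []; rewrite /side /= tnth_mktuple. Qed.

End Presentations.

Theorem theorem7 (R : realType) (A : finType) (k : nat)
    (hA : (1 < #|A|)%N) (hk : (0 < k)%N) :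
  (generically R (@sum_stratum (seq A) size k) (@monoid_wp_linear_time A k) /\
   generically R (@max_stratum (seq A) size k) (@monoid_wp_linear_time A k)) /\
  (generically R (@sum_stratum (neword A) (@neword_size A) k)
     (@semigroup_wp_linear_time A k) /\
   generically R (@max_stratum (neword A) (@neword_size A) k)
     (@semigroup_wp_linear_time A k)).
Proof.
have I0 : 0 < #|{: 'I_k * bool}| by rewrite card_prod card_ord card_bool muln_gt0 hk.
have /card_gt0P[a0 _] : 0 < #|A| by apply: ltnW.
(* Default value of [make2] at empty words, irrelevant for families of words of length at least
   1. *)
pose w0 : neword A := exist _ [:: a0] isT.
pose get2 (P : semigroup_pres A k) := val \o side P.
pose make2 (f : 'I_k * bool -> seq A) : semigroup_pres A k :=
  of_sides (fun i => insubd w0 (f i)).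
have inj1 := @side_inj k (seq A).
have make1 (f : 'I_k * bool -> seq A) : (forall i, 0 <= size (f i)) ->
    side (of_sides f) =1 f by move=> _; apply: side_of_sides.
have inj2 P Q : get2 P =1 get2 Q -> P = Q.
  by move=> h; apply: side_inj => i; apply: val_inj; apply: h.
have make2P f : (forall i, 1 <= size (f i)) -> get2 (make2 f) =1 f.
  move=> hf i; rewrite /get2 /= side_of_sides insubdK //.
  by rewrite unfold_in -size_eq0 -lt0n; apply: hf.
have min2 P i : 1 <= size (get2 P i).
  by rewrite lt0n size_eq0; apply: (valP (side P i)).
split; split.
- exists (good (@side k (seq A))); split; last exact: good_monoid_linear.
  apply: generic_criterion => [n|e]; first exact: (finite_monoid_strata A k n).1.
  have [n0 h] := sum_stratum_bad hA I0 (leq0n 1) inj1 make1 (fun _ _ => leq0n _) e.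
  exists n0 => n hn; apply: (h n hn); first exact: (finite_monoid_strata A k n).1.
  by apply/seteqP; split=> P /=; rewrite /sum_stratum /= sum_length_side.
- exists (good (@side k (seq A))); split; last exact: good_monoid_linear.
  apply: generic_criterion => [n|e]; first exact: (finite_monoid_strata A k n).2.
  have [n0 h] := max_stratum_bad hA I0 (leq0n 1) inj1 make1 (fun _ _ => leq0n _) e.
  exists n0 => n hn; apply: (h n hn); first exact: (finite_monoid_strata A k n).2.
  by apply/seteqP; split=> P /=; rewrite /max_stratum /= max_length_side.
- exists (good get2); split; last exact: good_semigroup_linear.
  apply: generic_criterion => [n|e]; first exact: (finite_semigroup_strata A k n).1.
  have [n0 h] := sum_stratum_bad hA I0 (leqnn 1) inj2 make2P min2 e.
  exists n0 => n hn; apply: (h n hn); first exact: (finite_semigroup_strata A k n).1.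
  by apply/seteqP; split=> P /=; rewrite /sum_stratum /= sum_length_side.
- exists (good get2); split; last exact: good_semigroup_linear.
  apply: generic_criterion => [n|e]; first exact: (finite_semigroup_strata A k n).2.
  have [n0 h] := max_stratum_bad hA I0 (leqnn 1) inj2 make2P min2 e.
  exists n0 => n hn; apply: (h n hn); first exact: (finite_semigroup_strata A k n).2.
  by apply/seteqP; split=> P /=; rewrite /max_stratum /= max_length_side.
Qed.
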